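(* Let $U$ (with $\tau$-operator $\mathcal{T}$) be a folded representation over $k$ of a root datum $\Phi\hookrightarrow\Lambda^\vee$ with simple roots $\Delta$, and suppose that $(U,\mathcal{T})$ preserves $\Theta\subset\Delta$. Let $\theta\in U$ be a dominant vector with respect to $\Delta$ whose stabilizer in $W$ is $W_\Theta$, let $\mu=\pi_*(\theta)$, and let $\mathcal{Z}(\mathcal{G})$ and $\mathcal{Z}(\mathcal{G}_\tau)$ be the associated structure algebras. Then the rule $$\iota^*\big((z_x)_{x\in W\theta}\big)=\big(\pi_*(z_{\iota(y)})\big)_{y\in W_\tau\mu}$$ (first restrict the family to the indices in $\iota(W_\tau\mu)\subset W\theta$, then apply $\pi_*\colon S\to S_\tau$ to each component) defines a ring homomorphism $\iota^*\colon\mathcal{Z}(\mathcal{G})\to\mathcal{Z}(\mathcal{G}_\tau)$. Moreover, $\iota^*$ induces a homomorphism $\bar\iota^*\colon\overline{\mathcal{Z}}(\mathcal{G})\to\overline{\mathcal{Z}}(\mathcal{G}_\tau)$ of the augmented structure algebras such that $\bar\iota^*\circ f=f_\tau\circ\iota^*$, all maps being $k$-algebra homomorphisms.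
   Context: **Quadratic algebra.** $k$ is a subring of $\mathbb{R}$; $p(x)=x^2-c_1x+c_2$ is a polynomial over $k$ with $c_2$ and $D=c_1^2-4c_2$ invertible in $k$; $l=k[x]/(p(x))$; $\tau$ is the class of $x$ and $\sigma=c_1-\tau$, so $\tau+\sigma=c_1$, $\tau\sigma=c_2$. Write $(y,y')=y+\tau y'\in l$ for $y,y'\in k$. Two cases are considered: the split case, where $p(x)=x^2-1$, $2$ is invertible in $k$ and $l\cong k\times k$; and the non-split case, where $l\not\cong k\times k$ and $l$ is a subring of $\mathbb{R}$. **Weil restriction.** $\mathcal{U}=l^n$; $U$ is $\mathcal{U}$ viewed as a free $k$-module of rank $2n$ (coordinates $(y_i,y_i')_{i}$); for $u\in U$, $u_l$ is $u$ viewed in $\mathcal{U}$. $\mathcal{T}\colon U\to U$ is multiplication by $\tau$, $(\mathcal{T}u)_l=\tau u_l$. $B_\tau(u,\hat u)=pr_\tau(u_l\cdot\hat u_l)$, where $\cdot$ is the standard $l$-bilinear dot product on $\mathcal{U}$ and $pr_\tau(y+\tau y')=y$. $U_l=U\otimes_kl$, $\mathcal{T}_l$ and $B_\tau$ are extended $l$-linearly; $U_\tau$ is the $\tau$-eigenspace of $\mathcal{T}_l$ and $\pi_\tau\colon U\to U_\tau$, $\pi_\tau(u)=\frac{1}{\tau-\sigma}(\mathcal{T}u-\sigma u)$. A nonzero $u\in U$ is $\tau$-rational if $u_l\cdot u_l\in k$. **Root datum and folded representation.** A root datum is an embedding $\Phi\hookrightarrow\Lambda^\vee$, $\alpha\mapsto\alpha^\vee$,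 of a non-empty finite subset $\Phi$ of a free finitely generated abelian group $\Lambda$ into $\Lambda^\vee=\mathrm{Hom}(\Lambda,\mathbb{Z})$ with $\Phi\cap2\Phi=\emptyset$, $\alpha^\vee(\alpha)=2$, $\beta-\alpha^\vee(\beta)\alpha\in\Phi$ and $\beta^\vee-\beta^\vee(\alpha)\alpha^\vee\in\Phi^\vee$ for all $\alpha,\beta\in\Phi$ ($\Phi^\vee$ is the image of $\Phi$). $\Lambda_r$ is the subgroup generated by $\Phi$ (root lattice), $\Delta$ is a fixed set of simple roots, $\Phi^+$ the positive roots. $U$ is a folded representation of it if $\Phi\subset U$ (so $\Lambda_r\subset U$) and: (1) $U$ is the Weil restriction of $\mathcal{U}=l^n$ with respect to $l/k$, i.e. $U$ is the free $l$-module $\mathcal{U}=l^n$ viewed as a free $k$-module of rank $2n$ with coordinates $(y_i,y_i')_i$, where $l=k[x]/(p(x))$ and $x_i=y_i+\tau y_i'$ are the coordinates in $l^n$; (2) the standard dot product $B$ on $U$ in the coordinates $(y_i,y_i')$ equals $B_\tau$ (so $c_2=-1$), and $\alpha^\vee(u)=2B(\alpha,u)/B(\alpha,\alpha)$; the reflections $r_\alpha(u)=u-\alpha^\vee(u)\alpha$, $\alpha\in\Phi$, are $k$-linear automorphisms of $U$; (3) $\mathcal{T}(\Lambda_r)=\Lambda_r$; (4) $\Delta=\Delta^{\mathcal{T}}\amalg\Delta_{rat}\amalg\mathcal{T}(\Delta_{rat})$, where $\Delta^{\mathcal{T}}=\{\alpha\in\Delta:\mathcal{T}\alpha=\alpha\}$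 and $\Delta_{rat}$ is a subset consisting of $\tau$-rational simple roots. In the non-split case $\tau>0$ is assumed (and then $\Delta^{\mathcal{T}}=\emptyset$). $W$ is the Weyl group generated by the $r_\alpha$, $\alpha\in\Delta$. **Convention.** In the non-split case put $U_*=U_\tau$, $\pi_*=\pi_\tau$, $l_*=l$. In the split case put $U_*=U_1=\{u\in U:\mathcal{T}u=u\}$, $\pi_*(u)=\frac12(u+\mathcal{T}u)$, $l_*=k$. **Twisted folding.** For $\alpha\in\Delta_{rat}\amalg\Delta^{\mathcal{T}}$ put $\bar\alpha=\pi_*(\alpha)$; $R_{\bar\alpha}$ is the restriction to $U_*$ of ($l_*$-linearly extended) $r_{\mathcal{T}\alpha}r_\alpha$ if $\alpha\in\Delta_{rat}$, and of $r_\alpha$ if $\alpha\in\Delta^{\mathcal{T}}$. $W_\tau$ is the group generated by these $R_{\bar\alpha}$; it is identified with the subgroup of $W$ generated by the corresponding $r_{\mathcal{T}\alpha}r_\alpha$ and $r_\alpha$. $\Delta_\tau=\pi_*(\Delta_{rat}\amalg\Delta^{\mathcal{T}})$, $\Phi_\tau=W_\tau(\Delta_\tau)$, $\Phi_\tau^+$ are the roots that are nonnegative combinations of $\Delta_\tau$; for $\beta=w(\bar\alpha)\in\Phi_\tau$, $R_\beta=wR_{\bar\alpha}w^{-1}$. **Parabolic data.** $(U,\mathcal{T})$ preserves $\Theta\subset\Delta$ if $\mathcal{T}(\langle\Theta\rangle_k)=\langle\Theta\rangle_k$, where $\langle\Theta\rangle_k$ is the $k$-span. $W_\Theta\subset W$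 is generated by the $r_\alpha$, $\alpha\in\Theta$. A vector $\theta\in U$ is dominant if $B_\tau(\theta,\beta)\ge0$ for all $\beta\in\Delta$. The map $\iota\colon W_\tau\mu\hookrightarrow W\theta$, $w\mu\mapsto w\theta$ ($w\in W_\tau\subset W$) is a well-defined injection. **Structure algebras.** $\Lambda$ is regarded as a subgroup of $U$ containing $\Lambda_r$, stable under $\mathcal{T}$ and $W$, with $\alpha^\vee$ given by the formula $\alpha^\vee(u)=2B(\alpha,u)/B(\alpha,\alpha)$. $S=\mathrm{Sym}_k(\Lambda)$; $\Lambda_\tau$ is the $l_*$-span of $\pi_*(\Lambda)$ in $U_*$, a free $l_*$-module; $S_\tau=\mathrm{Sym}_{l_*}(\Lambda_\tau)$; $\pi_*$ induces a graded $k$-algebra homomorphism $\pi_*\colon S\to S_\tau$. With componentwise operations, $$\mathcal{Z}(\mathcal{G})=\Big\{(z_x)\in\bigoplus_{x\in W\theta}S : z_x-z_{r_\alpha x}\in\alpha S\ \ \forall x\in W\theta,\ \alpha\in\Phi^+\Big\},$$ $$\mathcal{Z}(\mathcal{G}_\tau)=\Big\{(b_y)\in\bigoplus_{y\in W_\tau\mu}S_\tau : b_y-b_{R_\beta y}\in\beta S_\tau\ \ \forall y\in W_\tau\mu,\ \beta\in\Phi_\tau^+\Big\}.$$ $\mathcal{I}\subset S$ and $\mathcal{I}_\tau\subset S_\tau$ are the augmentation ideals (zero constant term). $\overline{\mathcal{Z}}(\mathcal{G})=\mathcal{Z}(\mathcal{G})/\mathcal{I}\mathcal{Z}(\mathcal{G})$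 and $\overline{\mathcal{Z}}(\mathcal{G}_\tau)=\mathcal{Z}(\mathcal{G}_\tau)/\mathcal{I}_\tau\mathcal{Z}(\mathcal{G}_\tau)$ are the augmented structure algebras, with quotient maps $f$ and $f_\tau$. *)

(* Defs.v *)
From HB Require Import structures.
From mathcomp Require Import all_boot all_order all_algebra.
From mathcomp Require Import boolp reals.
From mathcomp Require Import mpoly.
From mathcomp Require Import ring.

Set Implicit Arguments.
Unset Strict Implicit.
Unset Printing Implicit Defensive.

Import Order.TTheory GRing.Theory Num.Theory.
Local Open Scope ring_scope.

(** ** The quadratic algebra l = k[x]/(x^2 - c1 x + c2) *)

Definition quad_poly (k : comNzRingType) (c1 c2 : k) : {poly k} :=
  'X^2 - c1 *: 'X + c2%:P.

Definition quad_alg (k : comNzRingType) (c1 c2 : k) : comAlgType k :=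
  {poly %/ quad_poly c1 c2}.

Section QuadraticAlgebra.
Variables (k : idomainType) (c1 c2 : k).
Local Notation l := (quad_alg c1 c2).

Definition quad_disc : k := c1 ^+ 2 - 4 * c2.

Definition to_l : {rmorphism k -> l} := qpolyC (quad_poly c1 c2).

Definition tau : l := 'qX.
Definition sigma : l := to_l c1 - tau.

(* The two coordinates of y + tau y' are the coefficients of the
   representative of degree < 2. *)
Definition pr_tau (z : l) : k := ((z : {poly %/ quad_poly c1 c2}) : {poly k})`_0.
Definition pr_tau' (z : l) : k := ((z : {poly %/ quad_poly c1 c2}) : {poly k})`_1.

(* 1 / (tau - sigma), using (tau - sigma)^2 = D: see [tau_sigma_invP]. *)
Definition tau_sigma_inv : l := quad_disc^-1 *: (tau - sigma).

Lemma quad_poly_size : size (quad_poly c1 c2) = 3.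
Proof.
rewrite /quad_poly -addrA size_polyDl size_polyXn //.
apply: leq_ltn_trans (size_polyD _ _) _; rewrite gtn_max size_polyN.
rewrite (leq_ltn_trans (size_scale_leq _ _)) ?size_polyX //.
by rewrite (leq_ltn_trans (size_polyC_leq1 _)).
Qed.

Lemma quad_poly_monic : quad_poly c1 c2 \is monic.
Proof.
rewrite monicE lead_coefE quad_poly_size /= /quad_poly.
by rewrite !coefD coefN coefZ coefXn coefX coefC /= mulr0 oppr0 !addr0.
Qed.

Lemma mk_monic_quad : mk_monic (quad_poly c1 c2) = quad_poly c1 c2.
Proof. by rewrite /mk_monic quad_poly_size quad_poly_monic. Qed.

Lemma tau_root : tau ^+ 2 = to_l c1 * tau - to_l c2.
Proof.
have E q : to_l q = in_qpoly (quad_poly c1 c2) q%:P.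
  apply/val_inj; symmetry; apply: in_qpoly_small.
  by rewrite mk_monic_quad quad_poly_size (leq_ltn_trans (size_polyC_leq1 _)).
rewrite !E /tau /qpolyX -rmorphXn -rmorphM -rmorphB /=.
apply/eqP; rewrite -subr_eq0 -rmorphB /=; apply/eqP/val_inj => /=.
have -> : 'X^2 - (c1%:P * 'X - c2%:P) = quad_poly c1 c2.
  by rewrite /quad_poly mul_polyC opprB addrA addrAC.
by rewrite mk_monic_quad Pdiv.RingMonic.rmodpp // quad_poly_monic.
Qed.

Lemma tau_sigma_invP :
  quad_disc \is a GRing.unit -> (tau - sigma) * tau_sigma_inv = 1.
Proof.
move=> Du; rewrite /tau_sigma_inv -scalerAr.
have -> : (tau - sigma) * (tau - sigma) = to_l quad_disc.
  rewrite /quad_disc rmorphB rmorphXn rmorphM rmorph_nat.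
  have -> : (tau - sigma) * (tau - sigma)
      = 4 * (tau ^+ 2 - to_l c1 * tau) + to_l c1 ^+ 2 by rewrite /sigma; ring.
  by rewrite tau_root; ring.
apply/val_inj; apply: etrans (poly_of_qpolyZ _ _) _.
by rewrite /= -mul_polyC -polyCM mulVr.
Qed.

End QuadraticAlgebra.

(** ** Generated groups and extension of scalars

  Vectors are rows and a linear map u |-> g(u) is the matrix with
  g(u) = u *m g; so [g *m h] is "g, then h". *)

Inductive generated (A : comUnitRingType) (m : nat) (G : 'M[A]_m -> Prop) :
    'M[A]_m -> Prop :=
| gen_one : generated G 1%:M
| gen_mul g h : G g -> generated G h -> generated G (g *m h)
| gen_inv g h : G g -> generated G h -> generated G (invmx g *m h).

Section GeneratedTheory.
Variables (A : comUnitRingType) (m : nat).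
Implicit Types G H : 'M[A]_m -> Prop.

Lemma generated_mul G g h : generated G g -> generated G h -> generated G (g *m h).
Proof.
move=> Gg Gh; elim: Gg => [|x y Gx _ IH|x y Gx _ IH].
- by rewrite mul1mx.
- by rewrite -mulmxA; apply: gen_mul.
- by rewrite -mulmxA; apply: gen_inv.
Qed.

Lemma generated_sub G H :
  (forall g, G g -> generated H g /\ generated H (invmx g)) ->
  forall g, generated G g -> generated H g.
Proof.
move=> GH g; elim=> [|x y /GH[Hx _] _ IH|x y /GH[_ Hx] _ IH].
- exact: gen_one.
- exact: generated_mul.
- exact: generated_mul.
Qed.

End GeneratedTheory.

(** ** Root data in Lambda = Z^r

  Hom(Lambda, Z) is the space of integral columns, acting by [pairing]. *)

Definition pairing r (f : 'cV[int]_r) (x : 'rV[int]_r) : int := (x *m f) 0 0.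

Record root_datum (r : nat) := RootDatum {
  roots : seq 'rV[int]_r;
  coroot : 'rV[int]_r -> 'cV[int]_r;
  roots_nonempty : roots != [::];
  coroot_inj : {in roots &, injective coroot};
  roots_reduced : {in roots, forall a, a *+ 2 \notin roots};
  pairing_self : {in roots, forall a, pairing (coroot a) a = 2};
  roots_stable : {in roots &, forall a b,
    b - pairing (coroot a) b *: a \in roots};
  coroots_stable : {in roots &, forall a b,
    coroot b - pairing (coroot b) a *: coroot a \in map coroot roots}
}.

Section RootDatum.
Variables (r : nat) (RD : root_datum r).

Definition root_lattice (x : 'rV[int]_r) : Prop :=
  exists c : 'rV[int]_r -> int, x = \sum_(a <- roots RD) c a *: a.

Definition nneg_int_comb (Delta : seq 'rV[int]_r) (x : 'rV[int]_r) : Prop :=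
  exists c : 'rV[int]_r -> nat, x = \sum_(a <- Delta) a *+ c a.

Record simple_roots (Delta : seq 'rV[int]_r) : Prop := SimpleRoots {
  simple_uniq : uniq Delta;
  simple_sub : {subset Delta <= roots RD};
  simple_free : forall c : 'rV[int]_r -> int,
    \sum_(a <- Delta) c a *: a = 0 -> {in Delta, forall a, c a = 0};
  simple_span : {in roots RD, forall a,
    nneg_int_comb Delta a \/ nneg_int_comb Delta (- a)}
}.

Definition positive_root (Delta : seq 'rV[int]_r) (a : 'rV[int]_r) : Prop :=
  a \in roots RD /\ nneg_int_comb Delta a.

End RootDatum.

(** ** The Weil restriction U of l^n

  A vector of U has coordinates (y_1, .., y_n, y'_1, .., y'_n). *)

Section WeilRestriction.
Variables (k : idomainType) (c1 c2 : k) (n : nat).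
Local Notation l := (quad_alg c1 c2).
Local Notation U := 'rV[k]_(n + n).

Definition dotp (A : comNzRingType) (m : nat) (u v : 'rV[A]_m) : A :=
  (u *m v^T) 0 0.

Definition to_ln (u : U) : 'rV[l]_n :=
  map_mx (to_l c1 c2) (lsubmx u) + tau c1 c2 *: map_mx (to_l c1 c2) (rsubmx u).

Definition of_ln (v : 'rV[l]_n) : U :=
  row_mx (map_mx (@pr_tau k c1 c2) v) (map_mx (@pr_tau' k c1 c2) v).

Definition T_op (u : U) : U := of_ln (tau c1 c2 *: to_ln u).

Definition B_tau (u v : U) : k := pr_tau (dotp (to_ln u) (to_ln v)).

Definition tau_rational (u : U) : Prop :=
  u <> 0 /\ exists c : k, dotp (to_ln u) (to_ln u) = to_l c1 c2 c.

End WeilRestriction.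

(** ** Folded representations *)

Section FoldedRepresentation.
Variables (R : realType) (k : idomainType) (kR : {rmorphism k -> R}).
Variables (c1 c2 : k) (r n : nat) (RD : root_datum r).
Variable Delta : seq 'rV[int]_r.
Local Notation Lambda := 'rV[int]_r.
Local Notation U := 'rV[k]_(n + n).
Local Notation T := (@T_op k c1 c2 n).

(* 2 B(a, u) / B(a, a) need not lie in k, only in R. *)
Definition coroot_form (a u : U) : R :=
  2 * kR (dotp a u) / kR (dotp a a).

Record folded_rep := FoldedRep {
  (* the inclusion of Lambda, hence of Phi and Lambda_r, in U *)
  fr_incl : {additive Lambda -> U};
  fr_incl_inj : injective fr_incl;
  fr_dot : forall u v : U, dotp u v = B_tau c1 c2 u v;
  fr_coroot : {in roots RD, forall a x,
    (pairing (coroot RD a) x)%:~R = coroot_form (fr_incl a) (fr_incl x)};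
  (* r_a for a in Phi, as a matrix over k *)
  fr_refl : U -> 'M[k]_(n + n);
  fr_reflE : {in roots RD, forall a u,
    map_mx kR (u *m fr_refl (fr_incl a)) =
    map_mx kR u - coroot_form (fr_incl a) u *: map_mx kR (fr_incl a)};
  fr_refl_unit : {in roots RD, forall a, fr_refl (fr_incl a) \in unitmx};
  fr_T_root_lattice : forall u : U,
    (exists2 x, root_lattice RD x & u = T (fr_incl x)) <->
    (exists2 x, root_lattice RD x & u = fr_incl x);
  fr_T_Lambda : forall x, exists y, T (fr_incl x) = fr_incl y;
  fr_W_Lambda : {in roots RD, forall a x,
    exists y, fr_incl x *m fr_refl (fr_incl a) = fr_incl y};
  (* Delta_rat; [fr_Delta] states the disjoint union (Delta being
     duplicate-free) and in particular that Delta_rat is included in Delta *)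
  fr_rat : seq Lambda;
  fr_rat_rational : {in fr_rat, forall a, tau_rational c1 c2 (fr_incl a)};
  fr_Delta : perm_eq (map fr_incl Delta)
    ([seq fr_incl a | a <- Delta & T (fr_incl a) == fr_incl a] ++
     [seq fr_incl a | a <- fr_rat] ++ [seq T (fr_incl a) | a <- fr_rat])
}.

End FoldedRepresentation.

Section WeylGroup.
Variables (R : realType) (k : idomainType) (kR : {rmorphism k -> R}).
Variables (c1 c2 : k) (r n : nat) (RD : root_datum r).
Variable Delta : seq 'rV[int]_r.
Variable F : folded_rep kR c1 c2 n RD Delta.
Local Notation Lambda := 'rV[int]_r.
Local Notation U := 'rV[k]_(n + n).
Local Notation T := (@T_op k c1 c2 n).

(* W_Theta; the Weyl group is W = W_Delta. *)
Definition weyl (Theta : seq Lambda) : 'M[k]_(n + n) -> Prop :=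
  generated (fun g => exists2 a, a \in Theta & g = fr_refl F (fr_incl F a)).

Definition span_k (Theta : seq Lambda) (u : U) : Prop :=
  exists c : Lambda -> k, u = \sum_(a <- Theta) c a *: fr_incl F a.

Definition preserves (Theta : seq Lambda) : Prop :=
  forall u : U, (exists2 v, span_k Theta v & u = T v) <-> span_k Theta u.

Definition dominant (theta : U) : Prop :=
  {in Delta, forall b, 0 <= kR (B_tau c1 c2 theta (fr_incl F b))}.

(* Delta_rat together with Delta^T *)
Definition fold_index : seq Lambda :=
  fr_rat F ++ [seq a <- Delta | T (fr_incl F a) == fr_incl F a].

(* r_{T a} r_a if a is in Delta_rat, r_a if a is in Delta^T *)
Definition fold_refl (a : Lambda) : 'M[k]_(n + n) :=
  if a \in fr_rat F
  then fr_refl F (fr_incl F a) *m fr_refl F (T (fr_incl F a))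
  else fr_refl F (fr_incl F a).

(* W_tau, as a subgroup of W *)
Definition weyl_tau : 'M[k]_(n + n) -> Prop :=
  generated (fun g => exists2 a, a \in fold_index & g = fold_refl a).

End WeylGroup.

(** ** The ring l_*, the space U_* and the map pi_*

  [split = true] is the split case, [split = false] the non-split one.
  U_* is the eigenspace of T for [tau_star] in U tensor l_* (so U_1 or U_tau). *)

Section Star.
Variables (k : idomainType) (c1 c2 : k) (n : nat).
Local Notation l := (quad_alg c1 c2).
Local Notation U := 'rV[k]_(n + n).
Local Notation T := (@T_op k c1 c2 n).

Definition l_star (split : bool) : comNzRingType :=
  if split then (k : comNzRingType) else (l : comNzRingType).

Definition to_star (split : bool) : {rmorphism k -> l_star split} :=
  if split return {rmorphism k -> l_star split}
  then (idfun : {rmorphism k -> k}) else to_l c1 c2.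

Definition tau_star (split : bool) : l_star split :=
  if split return l_star split then 1 else tau c1 c2.

Definition ext_mx (split : bool) m1 m2 (g : 'M[k]_(m1, m2)) :
  'M[l_star split]_(m1, m2) := map_mx (to_star split) g.

(* v lies in U_* *)
Definition in_U_star (split : bool) (v : 'rV[l_star split]_(n + n)) : Prop :=
  v *m ext_mx split (lin1_mx T) = tau_star split *: v.

Definition pi_star (split : bool) : U -> 'rV[l_star split]_(n + n) :=
  if split return U -> 'rV[l_star split]_(n + n)
  then fun u => 2^-1 *: (u + T u)
  else fun u => tau_sigma_inv c1 c2 *:
    (map_mx (to_l c1 c2) (T u) - sigma c1 c2 *: map_mx (to_l c1 c2) u).

Definition splits_alg : Prop :=
  exists f : {rmorphism l -> (k * k)%type},
    bijective f /\ forall c, f (to_l c1 c2 c) = (c, c).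

(* [lR] is the embedding of l_* in R. *)
Definition folding_case (R : realType) (split : bool)
    (lR : {rmorphism l_star split -> R}) : Prop :=
  if split
  then [/\ quad_poly c1 c2 = 'X^2 - 1, (2 : k) \is a GRing.unit & splits_alg]
  else ~ splits_alg /\ 0 < lR (tau_star split).

End Star.

Section WeilRestrictionTheory.
Variables (k : idomainType) (c1 c2 : k) (n : nat).
Local Notation l := (quad_alg c1 c2).
Local Notation U := 'rV[k]_(n + n).
Local Notation T := (@T_op k c1 c2 n).

Fact pr_tau_linear : scalar (@pr_tau k c1 c2).
Proof. by move=> a x y; rewrite /pr_tau /= coefD coefZ. Qed.
Fact pr_tau'_linear : scalar (@pr_tau' k c1 c2).
Proof. by move=> a x y; rewrite /pr_tau' /= coefD coefZ. Qed.

Lemma to_l_scale (a : k) (z : l) : to_l c1 c2 a * z = a *: z.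
Proof.
rewrite -[z in RHS]mul1r scalerAl; congr (_ * _); apply/val_inj.
by apply: etrans (esym (poly_of_qpolyZ _ _)); rewrite /= -mul_polyC mulr1.
Qed.

Lemma tauE : tau c1 c2 = 'X :> {poly k}.
Proof. by rewrite /tau qpolyXE ?quad_poly_size ?quad_poly_monic. Qed.

Lemma quad_eta (z : l) : to_l c1 c2 (pr_tau z) + tau c1 c2 * to_l c1 c2 (pr_tau' z) = z.
Proof.
rewrite mulrC to_l_scale; apply/val_inj.
rewrite /= -[X in _ + _ *: X]/(qpoly.polyn (tau c1 c2)) tauE.
apply/polyP => i; rewrite coefD coefZ coefC coefX.
have sz : (size (z : {poly k}) <= 2)%N.
  apply: leq_trans (size_npoly z) _.
  by rewrite mk_monic_quad quad_poly_size.
case: i => [|[|i]] /=; rewrite ?mulr0 ?addr0 ?mulr1 ?add0r //.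
by rewrite nth_default // (leq_trans sz).
Qed.

Lemma of_lnK : cancel (@of_ln k c1 c2 n) (@to_ln k c1 c2 n).
Proof.
move=> v; rewrite /to_ln /of_ln row_mxKl row_mxKr; apply/rowP => i.
by rewrite !mxE quad_eta.
Qed.

Lemma to_lnE (u : U) i : to_ln c1 c2 u 0 i =
  to_l c1 c2 (u 0 (lshift n i)) + tau c1 c2 * to_l c1 c2 (u 0 (rshift n i)).
Proof. by rewrite /to_ln !mxE. Qed.

Lemma to_ln_lin a (u v : U) :
  to_ln c1 c2 (a *: u + v) = to_l c1 c2 a *: to_ln c1 c2 u + to_ln c1 c2 v.
Proof.
have G (L : comNzRingType) (f : {rmorphism k -> L}) t x y x' y' :
    f (a * x + y) + t * f (a * x' + y') =
    f a * (f x + t * f x') + (f y + t * f y').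
  by rewrite !rmorphD !rmorphM /=; ring.
have H j : (a *: u + v) 0 j = a * u 0 j + v 0 j by rewrite !mxE.
apply/rowP => i; rewrite to_lnE !H G -!to_lnE; symmetry.
by apply: etrans (mxE _ _ _ _) _; congr (_ + _); exact: mxE.
Qed.

Lemma quad_coef (a b : k) :
  to_l c1 c2 a + tau c1 c2 * to_l c1 c2 b = a%:P + b *: 'X :> {poly k}.
Proof. by rewrite mulrC to_l_scale -[X in _ = _ + _ *: X]tauE. Qed.

Lemma to_lnK : cancel (@to_ln k c1 c2 n) (@of_ln k c1 c2 n).
Proof.
move=> u; rewrite -[RHS]hsubmxK /of_ln.
by congr row_mx; apply/rowP => i; rewrite [LHS]mxE [RHS]mxE to_lnE
  /pr_tau /pr_tau' quad_coef coefD coefZ coefC coefX /= ?mulr0 ?addr0 ?mulr1 ?add0r.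
Qed.

Lemma to_ln_T u : to_ln c1 c2 (T u) = tau c1 c2 *: to_ln c1 c2 u.
Proof. exact: of_lnK. Qed.

Fact T_op_linear : linear T.
Proof.
have G (L : comNzRingType) (V : lmodType L) (t b : L) (x y x' y' : V) :
    x' = t *: x -> y' = t *: y -> t *: (b *: x + y) = b *: x' + y'.
  by move=> -> ->; rewrite scalerDr !scalerA mulrC.
move=> a u v; apply: (can_inj to_lnK); rewrite to_ln_T.
rewrite [RHS](to_ln_lin a (T u) (T v)) (to_ln_lin a u v).
exact: G (to_ln_T u) (to_ln_T v).
Qed.
HB.instance Definition _ := GRing.isLinear.Build k U U *:%R T T_op_linear.

Lemma T_op_sqr u : T (T u) = c1 *: T u - c2 *: u.
Proof.
apply: (can_inj to_lnK); rewrite -scaleNr to_ln_lin -[- c2 *: u]addr0 to_ln_lin.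
have -> : to_ln c1 c2 (0 : U) = 0.
  by apply/rowP => i; rewrite to_lnE !mxE !rmorph0 mulr0 addr0.
have G (L : comNzRingType) (V : lmodType L) (t b c : L) (x y z : V) :
    t ^+ 2 = b * t - c -> y = t *: x -> z = t *: y -> z = b *: y + (- c *: x + 0).
  by move=> tE -> ->; rewrite addr0 !scalerA -expr2 tE scalerBl scaleNr.
rewrite [to_l _ _ (- c2)]rmorphN.
exact: G (tau_root c1 c2) (to_ln_T u) (to_ln_T (T u)).
Qed.

Lemma pi_star_U_star (R : realType) split (lR : {rmorphism l_star c1 c2 split -> R}) (u : U) :
  folding_case lR -> in_U_star (pi_star c1 c2 split u).
Proof.
have TE (v : U) : v *m lin1_mx T = T v by exact: mul_rV_lin1.
case: split lR => lR.
  case=> p1 _ _; rewrite /in_U_star /= /ext_mx map_mx_id //.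
  have := congr1 (fun p : {poly k} => p`_0) p1.
  have := congr1 (fun p : {poly k} => p`_1) p1.
  rewrite /quad_poly !coefE /= => c10 c20.
  pose simpq := (mulr0, mulr1, subr0, sub0r, oppr0, addr0, add0r).
  have c1E : c1 = 0 by move: c10; rewrite !simpq => /eqP; rewrite oppr_eq0 => /eqP.
  have c2E : c2 = - 1 by move: c20; rewrite c1E !simpq.
  by rewrite TE linearZ linearD /= T_op_sqr c1E c2E scale0r sub0r scaleN1r opprK scale1r addrC.
move=> _; rewrite /in_U_star /= /ext_mx /=.
rewrite -scalemxAl mulmxBl -scalemxAl -!map_mxM !TE scalerA mulrC -scalerA.
have G (L : comNzRingType) (V : lmodType L) (t b c : L) (x y : V) :
    c = t * (b - t) -> b *: y - c *: x - (b - t) *: y = t *: (y - (b - t) *: x).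
  move=> ->; rewrite -scalerA addrAC -scalerBl scalerBr.
  by congr (_ *: _ - _); rewrite opprB addrC subrK.
congr (_ *: _); rewrite T_op_sqr map_mxB !map_mxZ; apply: G.
by rewrite mulrBr -expr2 tau_root opprB mulrC addrC subrK.
Qed.
End WeilRestrictionTheory.

(** ** Structure algebras

  [edge x x' a] means that the condition z_x - z_x' \in a S is imposed, where
  S = {mpoly A[m]} is the symmetric algebra of the free A-module A^m.  A is a
  k-algebra through h; the base vertex x0 only makes the algebra nonzero. *)

Definition gkm (S : comNzRingType) (X : Type) (edge : X -> X -> S -> Prop)
    (z : X -> S) : Prop :=
  forall x x' a, edge x x' a -> exists s, z x - z x' = a * s.

Record str_alg (k A : comNzRingType) (h : {rmorphism k -> A}) (m : nat)
    (X : Type) (x0 : X) (edge : X -> X -> {mpoly A[m]} -> Prop) := StrAlg {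
  fam :> X -> {mpoly A[m]};
  famP : gkm edge fam
}.

Section StructureAlgebra.
Variables (k A : comNzRingType) (h : {rmorphism k -> A}) (m : nat).
Variables (X : Type) (x0 : X) (edge : X -> X -> {mpoly A[m]} -> Prop).
Local Notation S := {mpoly A[m]}.
Local Notation Z := (str_alg h x0 edge).

HB.instance Definition _ := gen_eqMixin Z.
HB.instance Definition _ := gen_choiceMixin Z.

Lemma famE (z w : Z) : fam z =1 fam w -> z = w.
Proof.
case: z w => [z Pz] [w Pw] /= /funext zw; subst w.
by congr StrAlg; apply: Prop_irrelevance.
Qed.

Lemma gkm_const (s : S) : gkm edge (fun=> s).
Proof. by move=> x x' a _; exists 0; rewrite subrr mulr0. Qed.

Lemma gkm_add (z w : Z) : gkm edge (fun x => z x + w x).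
Proof.
move=> x x' a e; have [s es] := famP z e; have [t et] := famP w e.
by exists (s + t); rewrite mulrDr -es -et opprD addrACA.
Qed.

Lemma gkm_opp (z : Z) : gkm edge (fun x => - z x).
Proof.
move=> x x' a e; have [s es] := famP z e.
by exists (- s); rewrite mulrN -es opprB opprK addrC.
Qed.

Lemma gkm_mul (z w : Z) : gkm edge (fun x => z x * w x).
Proof.
move=> x x' a e; have [s es] := famP z e; have [t et] := famP w e.
exists (s * w x + z x' * t).
by rewrite mulrDr mulrA -es mulrCA -et mulrBl mulrBr addrA subrK.
Qed.

Definition str_const s : Z := StrAlg h x0 (gkm_const s).
Definition str_add z w : Z := StrAlg h x0 (gkm_add z w).
Definition str_opp z : Z := StrAlg h x0 (gkm_opp z).
Definition str_mul z w : Z := StrAlg h x0 (gkm_mul z w).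
Definition str_scale (c : k) (z : Z) : Z := str_mul (str_const (h c)%:MP) z.

Fact str_addA : associative str_add.
Proof. by move=> x y z; apply: famE => t /=; rewrite addrA. Qed.
Fact str_addC : commutative str_add.
Proof. by move=> x y; apply: famE => t /=; rewrite addrC. Qed.
Fact str_add0 : left_id (str_const 0) str_add.
Proof. by move=> x; apply: famE => t /=; rewrite add0r. Qed.
Fact str_addN : left_inverse (str_const 0) str_opp str_add.
Proof. by move=> x; apply: famE => t /=; rewrite addNr. Qed.
HB.instance Definition _ :=
  GRing.isZmodule.Build Z str_addA str_addC str_add0 str_addN.

Fact str_mulA : associative str_mul.
Proof. by move=> x y z; apply: famE => t /=; rewrite mulrA. Qed.
Fact str_mulC : commutative str_mul.
Proof. by move=> x y; apply: famE => t /=; rewrite mulrC. Qed.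
Fact str_mul1 : left_id (str_const 1) str_mul.
Proof. by move=> x; apply: famE => t /=; rewrite mul1r. Qed.
Fact str_mulDl : left_distributive str_mul +%R.
Proof. by move=> x y z; apply: famE => t /=; rewrite mulrDl. Qed.
Fact str_one_neq0 : str_const 1 != 0.
Proof.
apply/eqP => /(congr1 (fun z : Z => z x0)) /= /eqP.
by rewrite oner_eq0.
Qed.
HB.instance Definition _ := GRing.Zmodule_isComNzRing.Build Z
  str_mulA str_mulC str_mul1 str_mulDl str_one_neq0.

Fact str_scaleA a b z : str_scale a (str_scale b z) = str_scale (a * b) z.
Proof. by apply: famE => t /=; rewrite rmorphM mpolyCM mulrA. Qed.
Fact str_scale1 : left_id 1 str_scale.
Proof. by move=> z; apply: famE => t /=; rewrite rmorph1 mpolyC1 mul1r. Qed.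
Fact str_scaleDr : right_distributive str_scale +%R.
Proof. by move=> a z w; apply: famE => t /=; rewrite mulrDr. Qed.
Fact str_scaleDl z : {morph str_scale^~ z : a b / a + b}.
Proof. by move=> a b; apply: famE => t /=; rewrite rmorphD mpolyCD mulrDl. Qed.
HB.instance Definition _ := GRing.Zmodule_isLmodule.Build k Z
  str_scaleA str_scale1 str_scaleDr str_scaleDl.

Fact str_scaleAl (a : k) (z w : Z) : a *: (z * w) = (a *: z) * w.
Proof. by apply: famE => t /=; rewrite mulrA. Qed.
HB.instance Definition _ := GRing.Lmodule_isLalgebra.Build k Z str_scaleAl.
HB.instance Definition _ := GRing.Lalgebra_isComAlgebra.Build k Z.

(* The ideal I Z, where I is the augmentation ideal of S. *)
Definition aug_ideal : {pred Z} := fun z => `[< exists s : seq (S * Z),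
  (forall q, q \in s -> (q.1)@_0%MM = 0) /\
  z = \sum_(q <- s) str_const q.1 * q.2 >].

Fact aug_ideal_closed : idealr_closed aug_ideal.
Proof.
split.
- by apply/asboolP; exists [::]; rewrite big_nil.
- apply/negP => /asboolP [s [s0]] /(congr1 (fun z : Z => (z x0)@_0%MM)) /=.
  have -> : (\sum_(q <- s) str_const q.1 * q.2 : Z) x0 =
            \sum_(q <- s) q.1 * q.2 x0.
    by elim/big_rec2: _ => [|q y1 y2 _ <-].
  rewrite raddf_sum big_seq big1 /=; last first.
    by move=> q /s0 q0; rewrite rmorphM /= [X in X * _]q0 mul0r.
  by move/eqP; rewrite mcoeff1 eqxx oner_eq0.
- move=> a u v /asboolP [s [s0 ->]] /asboolP [t [t0 ->]]; apply/asboolP.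
  exists ([seq (q.1, a * q.2) | q <- s] ++ t); split.
    by move=> q; rewrite mem_cat => /orP [/mapP [p /s0 p0 ->]|/t0].
  rewrite big_cat big_map mulr_sumr; congr (_ + _).
  by apply: eq_bigr => q _; rewrite mulrCA.
Qed.
HB.instance Definition _ := isIdealr.Build Z aug_ideal aug_ideal_closed.

End StructureAlgebra.

(** ** Quotients of commutative algebras *)

Section IdealQuotient.
Variables (k : comNzRingType) (B : comAlgType k) (I : idealr B).
Local Open Scope quotient_scope.
Local Notation Q := {ideal_quot I}.

Definition quot_scale (c : k) (q : Q) : Q := \pi_Q (c%:A) * q.

Fact quot_scaleA a b q : quot_scale a (quot_scale b q) = quot_scale (a * b) q.
Proof. by rewrite /quot_scale mulrA -rmorphM /= -scalerAl mul1r scalerA. Qed.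
Fact quot_scale1 : left_id 1 quot_scale.
Proof. by move=> q; rewrite /quot_scale scale1r rmorph1 mul1r. Qed.
Fact quot_scaleDr : right_distributive quot_scale +%R.
Proof. by move=> a p q; rewrite /quot_scale mulrDr. Qed.
Fact quot_scaleDl q : {morph quot_scale^~ q : a b / a + b}.
Proof. by move=> a b; rewrite /quot_scale scalerDl rmorphD mulrDl. Qed.
HB.instance Definition _ := GRing.Zmodule_isLmodule.Build k Q
  quot_scaleA quot_scale1 quot_scaleDr quot_scaleDl.

Fact quot_scaleAl (a : k) (p q : Q) : a *: (p * q) = (a *: p) * q.
Proof. by rewrite /GRing.scale /= /quot_scale mulrA. Qed.
HB.instance Definition _ := GRing.Lmodule_isLalgebra.Build k Q quot_scaleAl.
HB.instance Definition _ := GRing.Lalgebra_isComAlgebra.Build k Q.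

End IdealQuotient.

Section Augmented.
Variables (k A : comNzRingType) (h : {rmorphism k -> A}) (m : nat).
Variables (X : Type) (x0 : X) (edge : X -> X -> {mpoly A[m]} -> Prop).

(* Z / I Z and the quotient map *)
Definition aug_alg : comAlgType k := {ideal_quot (@aug_ideal k A h m X x0 edge)}.
Definition aug_proj (z : str_alg h x0 edge) : aug_alg :=
  (\pi_({ideal_quot (@aug_ideal k A h m X x0 edge)}) z)%qT.

Local Notation Z := (str_alg h x0 edge).
Local Notation Q := {ideal_quot (@aug_ideal k A h m X x0 edge)}.

Fact aug_proj_zmod : zmod_morphism aug_proj.
Proof. exact: (rmorphB (\pi_Q%qT : {rmorphism Z -> Q})). Qed.
Fact aug_proj_monoid : monoid_morphism aug_proj.
Proof.
split; first exact: (rmorph1 (\pi_Q%qT : {rmorphism Z -> Q})).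
exact: (rmorphM (\pi_Q%qT : {rmorphism Z -> Q})).
Qed.
HB.instance Definition _ :=
  GRing.isZmodMorphism.Build Z aug_alg aug_proj aug_proj_zmod.
HB.instance Definition _ :=
  GRing.isMonoidMorphism.Build Z aug_alg aug_proj aug_proj_monoid.

Fact aug_proj_scalable : scalable aug_proj.
Proof. by move=> c z; rewrite -mulr_algl rmorphM. Qed.
HB.instance Definition _ :=
  GRing.isScalable.Build k Z aug_alg *:%R aug_proj aug_proj_scalable.

End Augmented.

(** ** The structure algebras of the folding *)

Section Folding.
Variables (R : realType) (k : idomainType) (kR : {rmorphism k -> R}).
Variables (c1 c2 : k) (r n : nat) (RD : root_datum r).
Variable Delta : seq 'rV[int]_r.
Variable F : folded_rep kR c1 c2 n RD Delta.
Variables (split : bool) (lR : {rmorphism l_star c1 c2 split -> R}).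
Local Notation Lambda := 'rV[int]_r.
Local Notation U := 'rV[k]_(n + n).
Local Notation ls := (l_star c1 c2 split).
Local Notation Us := 'rV[l_star c1 c2 split]_(n + n).
Local Notation ext := (@ext_mx k c1 c2 split (n + n) (n + n)).
Local Notation pi := (@pi_star k c1 c2 n split).

Definition sym_lin (A : comNzRingType) (m : nat) (b : 'rV[A]_m) : {mpoly A[m]} :=
  \sum_i b 0 i *: 'X_i.

(* Lambda -> S = Sym_k(Lambda) = k[X_1, .., X_r] *)
Definition sym_Lambda (x : Lambda) : {mpoly k[r]} := sym_lin (map_mx intr x).

(* v lies in Lambda_tau, the l_*-span of pi_*(Lambda) *)
Definition in_Lambda_tau (v : Us) : Prop :=
  exists s : seq (ls * Lambda), v = \sum_(q <- s) q.1 *: pi (fr_incl F q.2).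

(* The rows of E form an l_*-basis of Lambda_tau. *)
Definition Lambda_tau_basis (m : nat) (E : 'M[ls]_(m, n + n)) : Prop :=
  injective (fun b : 'rV[ls]_m => b *m E) /\
  forall v, in_Lambda_tau v <-> exists b, v = b *m E.

Variables (m : nat) (E : 'M[ls]_(m, n + n)).

(* coordinates in the basis E (0 outside of Lambda_tau) *)
Definition coords (v : Us) : 'rV[ls]_m :=
  if pselect (exists b, v = b *m E) is left ex then sval (cid ex) else 0.

(* Lambda_tau -> S_tau = Sym_{l_*}(Lambda_tau) = l_*[X_1, .., X_m] *)
Definition sym_tau (v : Us) : {mpoly ls[m]} := sym_lin (coords v).

(* The k-algebra homomorphism S -> S_tau induced by pi_*. *)
Definition pi_S : {mpoly k[r]} -> {mpoly ls[m]} :=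
  mmap (@mpolyC m ls \o to_star c1 c2 split)
       (fun i => sym_tau (pi (fr_incl F (delta_mx 0 i)))).

Variable theta : U.
Definition mu : Us := pi theta.

(* W theta and W_tau mu; an element w of W_tau acts on U_* as the restriction
   of its l_*-linear extension. *)
Definition orbit : Type :=
  {x : U | exists2 w, weyl F Delta w & x = theta *m w}.
Definition orbit_tau : Type :=
  {y : Us | exists2 w, weyl_tau F w & y = mu *m ext w}.

Definition orbit_base : orbit :=
  exist _ theta (ex_intro2 _ _ 1%:M (gen_one _) (esym (mulmx1 theta))).

Fact orbit_tau_baseP : mu = mu *m ext 1%:M.
Proof. by rewrite /ext_mx map_mx1 mulmx1. Qed.
Definition orbit_tau_base : orbit_tau :=
  exist _ mu (ex_intro2 _ _ 1%:M (gen_one _) orbit_tau_baseP).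

(* The graph of iota : W_tau mu -> W theta, w mu |-> w theta. *)
Definition iota_graph (y : orbit_tau) (x : orbit) : Prop :=
  exists w, [/\ weyl_tau F w, sval y = mu *m ext w & sval x = theta *m w].

Definition edge (x x' : orbit) (s : {mpoly k[r]}) : Prop :=
  exists a, [/\ positive_root RD Delta a,
    sval x' = sval x *m fr_refl F (fr_incl F a) & s = sym_Lambda a].

(* v is a nonnegative combination of Delta_tau. *)
Definition nneg_comb_tau (v : Us) : Prop :=
  exists c : Lambda -> ls, (forall a, 0 <= lR (c a)) /\
    v = \sum_(a <- fold_index F) c a *: pi (fr_incl F a).

(* b = w(pi_*(a)) runs through Phi_tau^+ and w^-1 *m r *m w, with r the matrix
   of R_{pi_*(a)}, is the matrix of R_b = w R_{pi_*(a)} w^-1. *)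
Definition edge_tau (y y' : orbit_tau) (s : {mpoly ls[m]}) : Prop :=
  exists w a b, [/\ weyl_tau F w /\ a \in fold_index F,
    b = pi (fr_incl F a) *m ext w, nneg_comb_tau b,
    sval y' = sval y *m ext (invmx w *m fold_refl F a *m w) & s = sym_tau b].

(* Z(G) and Z(G_tau) *)
Definition Z_G : comAlgType k :=
  str_alg (idfun : {rmorphism k -> k}) orbit_base edge.
Definition Z_G_tau : comAlgType k :=
  str_alg (to_star c1 c2 split) orbit_tau_base edge_tau.

(* The augmented structure algebras, with the quotient maps f and f_tau. *)
Definition Zbar_G : comAlgType k :=
  aug_alg (idfun : {rmorphism k -> k}) orbit_base edge.
Definition Zbar_G_tau : comAlgType k :=
  aug_alg (to_star c1 c2 split) orbit_tau_base edge_tau.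
Definition f_G : {lrmorphism Z_G -> Zbar_G} :=
  @aug_proj k k (idfun : {rmorphism k -> k}) r orbit orbit_base edge.
Definition f_G_tau : {lrmorphism Z_G_tau -> Zbar_G_tau} :=
  @aug_proj k ls (to_star c1 c2 split) m orbit_tau orbit_tau_base edge_tau.

(* The rule z |-> (pi_*(z_iota(y)))_y. *)
Definition iota_rule (z : Z_G) (b : Z_G_tau) : Prop :=
  forall y x, iota_graph y x -> fam b y = pi_S (fam z x).

End Folding.

(** ** Consistency of the encodings *)

Section FoldingTheory.
Variables (R : realType) (k : idomainType) (kR : {rmorphism k -> R}).
Variables (c1 c2 : k) (r n : nat) (RD : root_datum r).
Variable Delta : seq 'rV[int]_r.
Variable F : folded_rep kR c1 c2 n RD Delta.
Variables (split : bool).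
Local Notation T := (@T_op k c1 c2 n).

Lemma fr_rat_T a : a \in fr_rat F ->
  a \in Delta /\ exists2 b, b \in Delta & T (fr_incl F a) = fr_incl F b.
Proof.
move=> ra; split.
  have : fr_incl F a \in map (fr_incl F) Delta.
    by rewrite (perm_mem (fr_Delta F)) !mem_cat (map_f (fr_incl F) ra) ?orbT.
  by case/mapP => b bD /(fr_incl_inj (f:=F)) ->.
apply/mapP; rewrite (perm_mem (fr_Delta F)) !mem_cat.
by rewrite (map_f (fun a => T (fr_incl F a)) ra) ?orbT.
Qed.

Lemma weyl_tau_sub w :
  {subset Delta <= roots RD} -> weyl_tau F w -> weyl F Delta w.
Proof.
move=> Dsub; apply: generated_sub => _ [a aF ->].
have S1 b : b \in Delta -> weyl F Delta (fr_refl F (fr_incl F b)) /\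
    weyl F Delta (invmx (fr_refl F (fr_incl F b))).
  move=> bD; have Hb : exists2 c, c \in Delta &
    fr_refl F (fr_incl F b) = fr_refl F (fr_incl F c) by exists b.
  split; first by rewrite -[fr_refl _ _]mulmx1; apply: gen_mul => //; apply: gen_one.
  by rewrite -[invmx _]mulmx1; apply: gen_inv => //; apply: gen_one.
rewrite /fold_refl; case: ifP => [/fr_rat_T [aD [b bD ->]]|a_rat].
  have [Wa Va] := S1 a aD; have [Wb Vb] := S1 b bD.
  split; first exact: generated_mul.
  have -> : invmx (fr_refl F (fr_incl F a) *m fr_refl F (fr_incl F b)) =
     invmx (fr_refl F (fr_incl F b)) *m invmx (fr_refl F (fr_incl F a)).
    have ua := fr_refl_unit F (Dsub _ aD); have ub := fr_refl_unit F (Dsub _ bD).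
    have uab : fr_refl F (fr_incl F a) *m fr_refl F (fr_incl F b) \in unitmx.
      by rewrite unitmx_mul ua; exact: ub.
    rewrite -[RHS](mulKmx uab) [X in _ = _ *m X](_ : _ = 1%:M) ?mulmx1 //.
    by rewrite mulmxA mulmxK // mulmxV.
  exact: generated_mul.
by move: aF; rewrite mem_cat a_rat mem_filter => /andP[_ /S1].
Qed.

(* iota is defined on all of W_tau mu. *)
Lemma iota_total theta (y : @orbit_tau R k kR c1 c2 r n RD Delta F split theta) :
  {subset Delta <= roots RD} -> exists x, iota_graph y x.
Proof.
case: y => y [w Ww yE] Dsub.
by exists (exist _ (theta *m w) (ex_intro2 _ _ w (weyl_tau_sub Dsub Ww) erefl)), w.
Qed.

Lemma sym_tauE m E v (b : 'rV_m): @Lambda_tau_basis R k kR c1 c2 r n RD Delta F split m E ->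
   v = b *m E -> sym_tau E v = sym_lin b.
Proof.
move=> [Einj _] vE; rewrite /sym_tau /coords; case: pselect => [ex|[]]; last by exists b.
by congr sym_lin; apply: Einj; rewrite -vE; case: cid => /= c.
Qed.

Lemma pi_star_zmod : zmod_morphism (@pi_star k c1 c2 n split).
Proof.
move=> u v; rewrite /pi_star; case: (split) => /=.
  by rewrite raddfB /= -scalerBr opprD addrACA.
have G (L : comNzRingType) (V : lmodType L) (t s : L) (a b x y : V) :
    t *: (a - b - s *: (x - y)) = t *: (a - s *: x) - t *: (b - s *: y).
  by rewrite -[RHS]scalerBr [s *: _]scalerBr !opprD !opprK addrACA.
by rewrite (raddfB (@T_op k c1 c2 n)) !map_mxB; apply: G.
Qed.
HB.instance Definition _ :=
  GRing.isZmodMorphism.Build _ _ (@pi_star k c1 c2 n split) pi_star_zmod.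

(* pi_S extends pi_* : Lambda -> Lambda_tau. *)
Lemma pi_S_Lambda m E x : @Lambda_tau_basis R k kR c1 c2 r n RD Delta F split m E ->
  pi_S F E (sym_Lambda k x) = sym_tau E (pi_star c1 c2 split (fr_incl F x)).
Proof.
move=> EB; pose b i := coords E (pi_star c1 c2 split (fr_incl F (delta_mx 0 i))).
have bE i : pi_star c1 c2 split (fr_incl F (delta_mx 0 i)) = b i *m E.
  rewrite /b /coords; case: pselect => [ex|[]]; first by case: cid.
  apply/EB.2; exists [:: (1, delta_mx 0 i)].
  by rewrite big_seq1 scale1r.
rewrite (@sym_tauE m E _ (\sum_i (x 0 i)%:~R *: b i) EB); last first.
  rewrite [in LHS](row_sum_delta x) !raddf_sum mulmx_suml; apply: eq_bigr => i _.
  rewrite -scalemxAl -bE -[x 0 i in LHS]intz scaler_int !raddfMz.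
  by rewrite scaler_int.
rewrite /pi_S /sym_Lambda /sym_lin raddf_sum /=.
under eq_bigr => i _ do rewrite mmapZ mmapX mmap1U mxE /= rmorph_int mul_mpolyC.
under [RHS]eq_bigr => i _ do rewrite summxE scaler_suml.
rewrite exchange_big; apply: eq_bigr => i _; rewrite /sym_tau /sym_lin scaler_sumr.
by apply: eq_bigr => j _; rewrite scalerA mxE.
Qed.
End FoldingTheory.

(* Main.v *)
(* An element of W_tau commutes with T: for a fixed simple root this is the
   symmetry of T for the dot product, and for a tau-rational a it holds because
   a and T a are orthogonal of equal length, c2 being -1.  Hence pi_* is
   W_tau-equivariant.  Since pi_*(T u) is a multiple of pi_*(u), the two
   divisibility conditions along x, r_a x, r_{T a} r_a x both become
   divisibility by pi_*(a) in S_tau, which is the condition of the folded graph.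

   That iota is well defined is clear in the non-split case, where pi_* is
   injective.  In the split case, if w fixes theta + T theta, then w can only
   decrease the pairings of theta with the dominant vectors theta and T theta;
   the two losses add up to 0, so w theta and theta have the same pairing with
   theta, and w theta = theta because w is an isometry. *)
Require Import Defs.
From HB Require Import structures.
From mathcomp Require Import all_boot all_order all_algebra.
From mathcomp Require Import boolp reals.
From mathcomp Require Import mpoly.
From mathcomp Require Import ring lra.

Set Implicit Arguments.
Unset Strict Implicit.
Unset Printing Implicit Defensive.

Import Order.TTheory GRing.Theory Num.Theory.
Local Open Scope ring_scope.

(** * Dot products and matrix preliminaries *)

Section DotProduct.
Variables (A : comNzRingType) (m : nat).
Implicit Types u v w : 'rV[A]_m.

Lemma dotpE u v : dotp u v = \sum_i u 0 i * v 0 i.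
Proof. by rewrite /dotp mxE; apply: eq_bigr => i _; rewrite mxE. Qed.

Lemma dotpC u v : dotp u v = dotp v u.
Proof. by rewrite !dotpE; apply: eq_bigr => i _; rewrite mulrC. Qed.

Lemma dotpDr u v w : dotp u (v + w) = dotp u v + dotp u w.
Proof. by rewrite /dotp linearD mulmxDr mxE. Qed.

Lemma dotpZr a u v : dotp u (a *: v) = a * dotp u v.
Proof. by rewrite /dotp linearZ -scalemxAr mxE. Qed.

Lemma dotp0r u : dotp u 0 = 0.
Proof. by rewrite -(scale0r u) dotpZr mul0r. Qed.

Lemma dotpBr u v w : dotp u (v - w) = dotp u v - dotp u w.
Proof. by rewrite -scaleN1r dotpDr dotpZr mulN1r. Qed.

Lemma dotpDl u v w : dotp (u + v) w = dotp u w + dotp v w.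
Proof. by rewrite dotpC dotpDr !(dotpC w). Qed.

Lemma dotpZl a u v : dotp (a *: u) v = a * dotp u v.
Proof. by rewrite dotpC dotpZr dotpC. Qed.

Lemma dotpBl u v w : dotp (u - v) w = dotp u w - dotp v w.
Proof. by rewrite dotpC dotpBr !(dotpC w). Qed.

End DotProduct.

Lemma dotp_map (A A' : comNzRingType) (h : {rmorphism A -> A'}) m (u v : 'rV_m) :
  dotp (map_mx h u) (map_mx h v) = h (dotp u v).
Proof.
by rewrite !dotpE rmorph_sum; apply: eq_bigr => i _; rewrite !mxE rmorphM.
Qed.

Lemma dotp_ge0 (R : realDomainType) m (u : 'rV[R]_m) : 0 <= dotp u u.
Proof. by rewrite dotpE; apply: sumr_ge0 => i _; rewrite -expr2 sqr_ge0. Qed.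

Lemma dotp_eq0 (R : realDomainType) m (u : 'rV[R]_m) : dotp u u = 0 -> u = 0.
Proof.
rewrite dotpE => /eqP; rewrite psumr_eq0 => [/allP u0|i _]; last first.
  by rewrite -expr2 sqr_ge0.
apply/rowP => i; have := u0 i (mem_index_enum i).
by rewrite -expr2 expf_eq0 /= mxE => /eqP.
Qed.

(** The quotient in [coroot_form] lives only in [R], so identities between reflections over [k] are
    checked after applying [kR] and brought back by this injectivity. *)
Lemma map_mx_injective (A A' : nzRingType) (h : {rmorphism A -> A'}) m n :
  injective h -> injective (@map_mx A A' h m n).
Proof.
by move=> hI M N /matrixP MN; apply/matrixP => i j; apply: hI; have := MN i j; rewrite !mxE.
Qed.

Lemma invmx_mul (A : comUnitRingType) m (g h : 'M[A]_m) :
  g \in unitmx -> h \in unitmx -> invmx (g *m h) = invmx h *m invmx g.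
Proof.
move=> gu hu; have ghu : g *m h \in unitmx by rewrite unitmx_mul gu.
by rewrite -[RHS](mulKmx ghu) !mulmxA !mulmxK.
Qed.

Lemma mx_row_ext (A : nzRingType) m n (g h : 'M[A]_(m, n)) :
  (forall u : 'rV_m, u *m g = u *m h) -> g = h.
Proof. by move=> gh; apply/row_matrixP => i; rewrite !rowE gh. Qed.

(** * The Weyl group and dominant vectors *)

Section GeneratedInverse.
Variables (A : comUnitRingType) (m : nat) (G : 'M[A]_m -> Prop).
Hypothesis G_unit : forall g, G g -> g \in unitmx.

Lemma generated_unit w : generated G w -> w \in unitmx.
Proof.
elim=> [|g h Gg _ hu|g h Gg _ hu]; first exact: unitmx1.
  by rewrite unitmx_mul G_unit.
by rewrite unitmx_mul unitmx_inv G_unit.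
Qed.

Lemma generated_inv w : generated G w -> generated G (invmx w).
Proof.
elim=> [|g h Gg Hh IH|g h Gg Hh IH].
- by rewrite invmx1; apply: gen_one.
- rewrite invmx_mul ?(generated_unit Hh) ?G_unit //; apply: generated_mul => //.
  by rewrite -[invmx g]mulmx1; apply: gen_inv => //; apply: gen_one.
- rewrite invmx_mul ?unitmx_inv ?(generated_unit Hh) ?G_unit // invmxK.
  apply: generated_mul => //.
  by rewrite -[g]mulmx1; apply: gen_mul => //; apply: gen_one.
Qed.

Lemma generated_in g : G g -> generated G g.
Proof. by move=> Gg; rewrite -[g]mulmx1; apply: gen_mul => //; apply: gen_one. Qed.

End GeneratedInverse.

Section Reflections.
Variables (R : realType) (k : idomainType) (kR : {rmorphism k -> R}).
Hypothesis kR_inj : injective kR.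
Variables (c1 c2 : k) (r n : nat) (RD : root_datum r).
Variable Delta : seq 'rV[int]_r.
Hypothesis DeltaP : simple_roots RD Delta.
Variable F : folded_rep kR c1 c2 n RD Delta.
Local Notation Lambda := 'rV[int]_r.
Local Notation U := 'rV[k]_(n + n).
Local Notation T := (@T_op k c1 c2 n).
Local Notation Phi := (Defs.roots RD).
Local Notation incl := (fr_incl F).
Local Notation refl a := (fr_refl F (incl a)).
Implicit Types (u v : U) (a b : Lambda) (w : 'M[k]_(n + n)).

Definition isometry w := forall u v, dotp (u *m w) (v *m w) = dotp u v.

Lemma isometry_mul w w' : isometry w -> isometry w' -> isometry (w *m w').
Proof. by move=> Iw Iw' u v; rewrite !mulmxA Iw' Iw. Qed.

Lemma isometry_coroot_form w u v :
  isometry w -> coroot_form kR (u *m w) (v *m w) = coroot_form kR u v.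
Proof. by move=> Iw; rewrite /coroot_form !Iw. Qed.

(** If the norm vanished, [coroot_form] would be 0 at the pair ([a], [a]), whereas a root pairs to 2
    with its own coroot. *)
Lemma root_norm_neq0 a : a \in Phi -> kR (dotp (incl a) (incl a)) != 0.
Proof.
move=> aR; apply/eqP => a0; have := fr_coroot F aR a.
by rewrite pairing_self // /coroot_form a0 mulr0 mul0r => /eqP; rewrite pnatr_eq0.
Qed.

Lemma root_opp a : a \in Phi -> - a \in Phi.
Proof.
move=> aR; have := roots_stable aR aR; rewrite pairing_self //.
by rewrite scaler_nat mulr2n opprD addrA subrr add0r.
Qed.

Lemma refl_lattice a x : a \in Phi ->
  incl x *m refl a = incl (x - pairing (coroot RD a) x *: a).
Proof.
move=> aR; apply: (map_mx_injective kR_inj).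
rewrite (fr_reflE F aR) -(fr_coroot F aR) raddfB /= map_mxB; congr (_ - _).
by rewrite -[pairing _ _ in RHS]intz !scaler_int !raddfMz.
Qed.

Lemma refl_root a b : a \in Phi -> b \in Phi ->
  exists2 b', b' \in Phi & incl b *m refl a = incl b'.
Proof.
by move=> aR bR; rewrite refl_lattice //; exists (b - pairing (coroot RD a) b *: a) => //;
  apply: roots_stable.
Qed.

Lemma refl_isometry a : a \in Phi -> isometry (refl a).
Proof.
move=> aR u v; apply: kR_inj; rewrite -!(dotp_map kR) !(fr_reflE F aR).
rewrite /coroot_form -!(dotp_map kR).
have := root_norm_neq0 aR; rewrite -(dotp_map kR) => a0.
rewrite !(dotpBl, dotpBr, dotpZl, dotpZr).
rewrite (dotpC (map_mx kR u) (map_mx kR (incl a))).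
by field.
Qed.

Lemma refl_invol a : a \in Phi -> refl a *m refl a = 1%:M.
Proof.
move=> aR; apply: mx_row_ext => u; rewrite mulmx1 mulmxA.
apply: (map_mx_injective kR_inj); rewrite (fr_reflE F aR) (fr_reflE F aR).
rewrite /coroot_form -!(dotp_map kR) (fr_reflE F aR) /coroot_form -!(dotp_map kR).
have := root_norm_neq0 aR; rewrite -(dotp_map kR) => a0.
rewrite dotpBr dotpZr -addrA -opprD -scalerDl.
set s := (X in X *: _); suff -> : s = 0 by rewrite scale0r subr0.
by rewrite /s; field.
Qed.

(** The reflection formula does not change when the root is rescaled; [c] cannot be 0 because [b]
    has nonzero norm. *)
Lemma refl_collinear a b (c : R) : a \in Phi -> b \in Phi ->
  map_mx kR (incl b) = c *: map_mx kR (incl a) -> refl b = refl a.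
Proof.
move=> aR bR ab; apply: mx_row_ext => u; apply: (map_mx_injective kR_inj).
rewrite (fr_reflE F aR) (fr_reflE F bR) /coroot_form -!(dotp_map kR) ab scalerA.
have := root_norm_neq0 aR; rewrite -(dotp_map kR) => a0.
have := root_norm_neq0 bR; rewrite -(dotp_map kR) ab !(dotpZr, dotpZl) !mulf_eq0.
rewrite (negPf a0) orbF.
rewrite orbb => c0.
by congr (_ - _ *: _); field; rewrite a0 c0.
Qed.

Lemma refl_opp a : a \in Phi -> refl (- a) = refl a.
Proof.
move=> aR; apply: (@refl_collinear _ _ (- 1)) => //; first exact: root_opp.
by rewrite raddfN /= map_mxN scaleN1r.
Qed.

(** An isometry preserves [coroot_form], so pushing the reflection formula for [a] through [w]
    yields the formula for the image of [a]. *)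
Lemma refl_conj w a b : isometry w -> a \in Phi -> b \in Phi ->
  incl a *m w = incl b -> refl a *m w = w *m refl b.
Proof.
move=> Iw aR bR ab; apply: mx_row_ext => u; apply: (map_mx_injective kR_inj).
rewrite !mulmxA (fr_reflE F bR) -ab isometry_coroot_form //.
by rewrite [LHS]map_mxM (fr_reflE F aR) mulmxBl -scalemxAl -!map_mxM.
Qed.

Lemma dominant_coroot_ge0 a u : kR (dotp (incl a) u) >= 0 ->
  0 <= coroot_form kR (incl a) u.
Proof.
by move=> au; rewrite /coroot_form !mulr_ge0 // invr_ge0 -dotp_map dotp_ge0.
Qed.

Local Notation word s := (foldr (fun a w => refl a *m w) 1%:M s).

Lemma word_cat s t : word (s ++ t) = word s *m word t.
Proof. by elim: s => [|a s IH] /=; rewrite ?mul1mx // IH mulmxA. Qed.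

Lemma cons_subset a s : a \in Delta -> {subset s <= Delta} -> {subset a :: s <= Delta}.
Proof. by move=> aD sD x; rewrite inE => /orP[/eqP ->|/sD]. Qed.

Lemma subset_cons_simple a s : {subset a :: s <= Delta} -> a \in Phi /\ {subset s <= Delta}.
Proof.
by move=> sD; split => [|x xs]; [apply/(simple_sub DeltaP)/sD/mem_head
  | apply: sD; rewrite inE xs orbT].
Qed.

Lemma word_isometry s : {subset s <= Delta} -> isometry (word s).
Proof.
elim: s => [|a s IH] /= sD; first by move=> u v; rewrite !mulmx1.
have [aR sD'] := subset_cons_simple sD.
by apply: isometry_mul; [exact: refl_isometry | exact: IH].
Qed.

Lemma weyl_gen_unit g : (exists2 a, a \in Delta & g = refl a) -> g \in unitmx.
Proof. by move=> [a aD ->]; apply/(fr_refl_unit F)/(simple_sub DeltaP). Qed.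

Lemma invmx_refl a : a \in Phi -> invmx (refl a) = refl a.
Proof.
move=> aR; have au := fr_refl_unit F aR.
by rewrite -[LHS]mulmx1 -(refl_invol aR) mulKmx.
Qed.

Lemma weyl_word w : weyl F Delta w -> exists2 s, {subset s <= Delta} & w = word s.
Proof.
elim=> [|g h [a aD ->] _ [s sD ->]|g h [a aD ->] _ [s sD ->]].
- by exists [::].
- by exists (a :: s) => //; apply: cons_subset.
- exists (a :: s) => /=; first exact: cons_subset.
  by rewrite invmx_refl //; apply: (simple_sub DeltaP).
Qed.

Lemma weyl_isometry w : weyl F Delta w -> isometry w.
Proof. by move=> /weyl_word [s sD ->]; apply: word_isometry. Qed.

Lemma word_root s a : {subset s <= Delta} -> a \in Phi ->
  exists2 b, b \in Phi & incl a *m word s = incl b.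
Proof.
elim: s a => [|b s IH] a /= sD aR; first by exists a; rewrite ?mulmx1.
have [bR sD'] := subset_cons_simple sD; have [a' a'R aa'] := refl_root bR aR.
by rewrite mulmxA aa'; apply: IH.
Qed.

Lemma weyl_root w a : weyl F Delta w -> a \in Phi ->
  exists2 b, b \in Phi & incl a *m w = incl b.
Proof. by move=> /weyl_word [s sD ->]; apply: word_root. Qed.

Lemma nneg_dot_ge0 (eta : U) b : {in Delta, forall a, 0 <= kR (dotp eta (incl a))} ->
  nneg_int_comb Delta b -> 0 <= kR (dotp eta (incl b)).
Proof.
move=> eta_dom [c ->]; rewrite raddf_sum big_seq.
elim/big_rec: _ => [|a x aD IH].
  by rewrite dotp0r rmorph0.
rewrite dotpDr rmorphD addr_ge0 //= raddfMn /= -scaler_nat dotpZr rmorphM rmorph_nat.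
by rewrite mulr_ge0 ?ler0n ?eta_dom.
Qed.

(* The reflection in the simple root [b] changes only the coefficient of [b],
   so a positive root that it makes negative is a multiple of [b]. *)
Lemma simple_refl_sign b x : b \in Delta -> x \in Phi ->
  nneg_int_comb Delta x ->
  nneg_int_comb Delta (- (x - pairing (coroot RD b) x *: b)) ->
  refl x = refl b.
Proof.
move=> bD xR [c xE] [d yE]; have bR := simple_sub DeltaP bD.
set t := pairing _ x in yE.
have pick (s : int) : s *: b = \sum_(a <- Delta) (if a == b then s else 0) *: a.
  rewrite (bigD1_seq b) ?(simple_uniq DeltaP) //= eqxx big1 ?addr0 // => a /negPf ->.
  by rewrite scale0r.
have natsum (e : Lambda -> nat) : \sum_(a <- Delta) (e a)%:Z *: a = \sum_(a <- Delta) a *+ e a.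
  by apply: eq_bigr => a _; rewrite -[(e a)%:Z]natz scaler_nat.
have /(simple_free DeltaP) cd0 : \sum_(a <- Delta)
    ((c a)%:Z + (d a)%:Z - (if a == b then t else 0)) *: a = 0.
  under eq_bigr do rewrite scalerBl scalerDl.
  rewrite sumrB big_split /= -pick.
  by rewrite !natsum -xE -yE opprB [x + _]addrC subrK subrr.
have c0 a : a \in Delta -> a != b -> c a = 0%N.
  move=> aD /negPf ab; have := cd0 a aD; rewrite ab subr0 => /eqP.
  by rewrite -PoszD eqz_nat addn_eq0 => /andP[/eqP].
have xb : x = (c b)%:Z *: b.
  rewrite pick xE big_seq [RHS]big_seq; apply: eq_bigr => a aD.
  have [->|ab] := eqVneq a b; last by rewrite c0 // mulr0n scale0r.
  by rewrite -[(c b)%:Z]natz scaler_nat.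
apply: (@refl_collinear _ _ (c b)%:R) => //.
by rewrite xb -[(c b)%:Z]natz scaler_nat raddfMn /= raddfMn /= scaler_nat.
Qed.

(** A form of the exchange condition. The root [a] is followed through the letters of [s]. If it
    first turns negative at a letter [b], it has there the same reflection as [b]; moving [refl a]
    past the preceding letters then deletes [b]. *)
Lemma word_sign s a : {subset s <= Delta} -> a \in Phi -> nneg_int_comb Delta a ->
  (exists2 b, nneg_int_comb Delta b & incl a *m word s = incl b) \/
  exists s1 s2, [/\ (size s1 + size s2 < size s)%N, {subset s1 ++ s2 <= Delta} &
    refl a *m word s = word (s1 ++ s2)].
Proof.
elim/last_ind: s => [|s b IH] sD aR a0.
  by left; exists a; rewrite ?mulmx1.
have [bD sD'] : b \in Delta /\ {subset s <= Delta}.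
  by split => [|x xs]; apply: sD; rewrite mem_rcons inE ?eqxx ?xs ?orbT.
have bR := simple_sub DeltaP bD.
case: (IH sD' aR a0) => [[x x0 ax]|[s1 [s2 [lt12 D12 E12]]]]; last first.
  right; exists s1, (rcons s2 b); rewrite !size_rcons addnS ltnS lt12; split => //.
    by move=> y; rewrite -rcons_cat mem_rcons inE => /orP[/eqP ->|/D12].
  by rewrite -!cats1 catA (word_cat (s1 ++ s2)) -E12 word_cat mulmxA.
have xR : x \in Phi.
  by have [y yR] := word_root sD' aR; rewrite ax => /(fr_incl_inj (f:=F)) ->.
have [y0|yN] := simple_span DeltaP (roots_stable bR xR).
  left; exists (x - pairing (coroot RD b) x *: b) => //.
  by rewrite -cats1 word_cat mulmxA ax /= mulmx1 refl_lattice.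
(* [refl a *m word s] equals [word s *m refl x], and [refl x = refl b] cancels the last letter. *)
right; exists s, [::]; rewrite addn0 size_rcons ltnSn cats0; split => //.
have xb := simple_refl_sign bD xR x0 yN.
rewrite -cats1 word_cat mulmxA (refl_conj (word_isometry sD') aR xR ax) xb /= mulmx1.
by rewrite -mulmxA refl_invol // mulmx1.
Qed.

(** Strong induction on the length. The first letter [a] subtracts a nonnegative multiple of [a]
    from [theta]. If the rest of the word keeps [a] positive, the pairing with [eta] can only drop;
    otherwise [word_sign] supplies a shorter word for the same element. *)
Lemma dominant_word_le (eta theta : U) s :
  {in Delta, forall a, 0 <= kR (dotp eta (incl a))} ->
  {in Delta, forall a, 0 <= kR (dotp theta (incl a))} ->
  {subset s <= Delta} ->
  kR (dotp eta (theta *m word s)) <= kR (dotp eta theta).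
Proof.
move=> eta_dom theta_dom; have [N] := ubnP (size s).
elim: N s => // N IH [|a s] /= sN sD; first by rewrite mulmx1.
have [aR sD'] := subset_cons_simple sD; have aD : a \in Delta by apply/sD/mem_head.
have [] := @word_sign s a sD' aR.
- exists (fun b => (b == a) : nat).
  rewrite (bigD1_seq a) ?(simple_uniq DeltaP) //= eqxx big1 ?addr0 // => b /negPf ->.
  by rewrite mulr0n.
- move=> [b b0 ab]; rewrite mulmxA -[X in X <= _](dotp_map kR) map_mxM (fr_reflE F aR).
  rewrite mulmxBl -scalemxAl -!map_mxM ab dotpBr dotpZr !dotp_map.
  rewrite lerBlDr; apply: le_trans (IH s _ sD') _; first by [].
  rewrite lerDl mulr_ge0 ?nneg_dot_ge0 // dominant_coroot_ge0 //.
  by rewrite dotpC theta_dom.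
- move=> [s1 [s2 [lt12 D12 ->]]]; apply: IH => //.
  by rewrite size_cat (leq_trans lt12) // ltnW.
Qed.

(* [w] fixes [theta + eta] and decreases both [(theta, .)] and [(eta, .)], so
   [(theta, theta w) = (theta, theta)], which forces [theta w = theta]. *)
Lemma stab_dominant_sum (theta eta : U) w : weyl F Delta w ->
  {in Delta, forall a, 0 <= kR (dotp theta (incl a))} ->
  {in Delta, forall a, 0 <= kR (dotp eta (incl a))} ->
  (theta + eta) *m w = theta + eta -> theta *m w = theta.
Proof.
move=> Ww th0 et0 fixw; have [s sD wE] := weyl_word Ww; have Iw := weyl_isometry Ww.
have le1 := dominant_word_le th0 th0 sD; rewrite -wE in le1.
have le2 := dominant_word_le et0 th0 sD; rewrite -wE in le2.
(* The isometry [w] fixes [theta + eta], so [theta] and [theta *m w] pair equally with that sum. *)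
have e : dotp theta (theta *m w) + dotp eta (theta *m w)
    = dotp theta theta + dotp eta theta by rewrite -!dotpDl -{1}fixw Iw.
have /(congr1 kR) := e; rewrite !rmorphD /= => e'.
have e1 : kR (dotp theta (theta *m w)) = kR (dotp theta theta) by lra.
(* Since [w] preserves norms, equality of the pairings gives [theta *m w - theta] norm 0, and the
   form is definite over [R]. *)
apply/eqP; rewrite -subr_eq0; apply/eqP/(map_mx_injective kR_inj)/etrans; last first.
  by rewrite map_mx0.
apply: dotp_eq0; rewrite dotp_map !(dotpBl, dotpBr) Iw (dotpC (theta *m w)).
by rewrite !rmorphB /= e1 subrr.
Qed.

(** * Compatibility with T and pi_* *)

Lemma pr_tauE (x y : k) : pr_tau (to_l c1 c2 x + tau c1 c2 * to_l c1 c2 y) = x.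
Proof. by rewrite /pr_tau quad_coef coefD coefZ coefC coefX /= mulr0 addr0. Qed.

(** [B_tau] is a bilinear form over the quadratic algebra followed by [pr_tau], so a factor [tau]
    may move between its arguments. *)
Lemma dotp_T u v : dotp (T u) v = dotp u (T v).
Proof.
rewrite [LHS](fr_dot F) [RHS](fr_dot F) /B_tau.
have swap (L : comNzRingType) m (t : L) (x y x' y' : 'rV[L]_m) :
    x' = t *: x -> y' = t *: y -> dotp x' y = dotp x y'.
  by move=> -> ->; rewrite dotpZl dotpZr.
by rewrite (swap _ _ _ _ _ _ _ (to_ln_T c1 c2 u) (to_ln_T c1 c2 v)).
Qed.

(** The two forms are compared on [tau] times a basis vector: the dot product gives 1, while [B_tau]
    gives the first coordinate of [tau ^+ 2], which is [- c2]. *)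
Lemma folded_c2 : c2 = -1.
Proof.
(* A root exists and has nonzero norm, which rules out [n = 0]. *)
have [i _] : exists i : 'I_n, True.
  have [a aR] : exists a, a \in Phi.
    by case: (Defs.roots RD) (roots_nonempty RD) => // a s _; exists a; apply: mem_head.
  case: (posnP n) => [n0|n_gt0]; last by exists (Ordinal n_gt0).
  have /eqP[] := root_norm_neq0 aR; rewrite dotpE big1 ?rmorph0 // => i _.
  have nn0 : (n + n <= 0)%N by rewrite n0.
  by have := leq_trans (ltn_ord i) nn0.
have := fr_dot F (delta_mx 0 (rshift n i)) (delta_mx 0 (rshift n i)).
rewrite /B_tau.
have -> : to_ln c1 c2 (delta_mx 0 (rshift n i)) = tau c1 c2 *: delta_mx 0 i.
  apply/rowP => j; rewrite to_lnE !mxE !eqxx /= eq_lrshift (inj_eq (@rshift_inj _ _)).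
  by rewrite rmorph0 add0r rmorph_nat.
have norm (A : comNzRingType) m (j : 'I_m) (t : A) :
    dotp (t *: delta_mx 0 j) (t *: delta_mx 0 j) = t ^+ 2.
  rewrite dotpE (bigD1 j) //= big1 ?addr0 ?mxE ?eqxx ?mulr1 // => i' /negPf ij.
  by rewrite !mxE ij andbF mulr0 mul0r.
rewrite norm -[X in dotp X X]scale1r norm expr1n tau_root addrC mulrC -rmorphN pr_tauE => ->.
by rewrite opprK.
Qed.

Lemma folded_T_sqr u : T (T u) = c1 *: T u + u.
Proof.
have c2N : - c2 = 1 by rewrite folded_c2 opprK.
by rewrite T_op_sqr -scaleNr c2N scale1r.
Qed.

Definition T_commuting w := forall u, T (u *m w) = T u *m w.

Lemma T_opE u : T u = u *m lin1_mx T.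
Proof. by rewrite mul_rV_lin1. Qed.

Lemma refl_T_fixed a : a \in Phi -> T (incl a) = incl a -> T_commuting (refl a).
Proof.
move=> aR Ta u; apply: (map_mx_injective kR_inj).
rewrite (fr_reflE F aR) [in LHS]T_opE map_mxM (fr_reflE F aR) mulmxBl -scalemxAl.
by rewrite -!map_mxM -!T_opE Ta /coroot_form -dotp_T Ta.
Qed.

Lemma refl_orthogonal a b u : a \in Phi -> b \in Phi -> dotp (incl a) (incl b) = 0 ->
  map_mx kR (u *m (refl a *m refl b)) = map_mx kR u
    - coroot_form kR (incl a) u *: map_mx kR (incl a)
    - coroot_form kR (incl b) u *: map_mx kR (incl b).
Proof.
move=> aR bR ab0; rewrite mulmxA (fr_reflE F bR) (fr_reflE F aR); congr (_ - _ *: _).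
rewrite /coroot_form -!(dotp_map kR) (fr_reflE F aR) dotpBr dotpZr.
by rewrite (dotpC (map_mx kR (incl b)) (map_mx kR (incl a))) (dotp_map kR (incl a))
  ab0 rmorph0 mulr0 subr0.
Qed.

(** The product over the quadratic algebra is [tau] times an element of [k], which [pr_tau]
    kills. *)
Lemma tau_rational_orthogonal u : tau_rational c1 c2 u -> dotp u (T u) = 0.
Proof.
move=> [_ [c uu]]; rewrite (fr_dot F) /B_tau (to_ln_T c1 c2 u) dotpZr uu.
by rewrite -[tau c1 c2 * _]add0r -(rmorph0 (to_l c1 c2)) pr_tauE.
Qed.

(** By orthogonality the product subtracts the two components along [a] and [b] independently. As
    [T] is symmetric and sends [a] to [b] and [b] to [c1 *: b + a], both sides have the same
    coefficients on [a] and [b]. *)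
Lemma refl_T_rational a b : a \in Phi -> b \in Phi -> T (incl a) = incl b ->
  tau_rational c1 c2 (incl a) -> T_commuting (refl a *m refl b).
Proof.
move=> aR bR Ta /tau_rational_orthogonal; rewrite Ta => ab0 u.
have Tb : T (incl b) = c1 *: incl b + incl a.
  by rewrite -Ta folded_T_sqr.
have bb : dotp (incl b) (incl b) = dotp (incl a) (incl a).
  by rewrite -{1}Ta dotp_T Tb dotpDr dotpZr ab0 mulr0 add0r.
apply: (map_mx_injective kR_inj); rewrite refl_orthogonal // [in LHS]T_opE map_mxM.
rewrite refl_orthogonal // !mulmxBl -!scalemxAl -!map_mxM -!T_opE Ta Tb.
rewrite /coroot_form -!dotp_T Ta Tb bb map_mxD map_mxZ dotpDl dotpZl rmorphD rmorphM /=.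
rewrite -!addrA; congr (_ + _); rewrite -!opprD; congr (- _).
rewrite scalerDr scalerA addrA [LHS]addrC -scalerDl; congr (_ + _ *: _).
by ring.
Qed.

Lemma fold_refl_unit a : a \in fold_index F -> fold_refl F a \in unitmx.
Proof.
have simple_unit b : b \in Delta -> refl b \in unitmx.
  by move=> bD; apply/(fr_refl_unit F)/(simple_sub DeltaP).
rewrite /fold_refl /fold_index mem_cat mem_filter.
case: ifP => [/fr_rat_T[aD [b bD ->]]|_] /=.
  by rewrite unitmx_mul simple_unit //= simple_unit.
by move=> /andP[_ /simple_unit].
Qed.

Lemma weyl_tau_gen_unit g : (exists2 a, a \in fold_index F & g = fold_refl F a) ->
  g \in unitmx.
Proof. by move=> [a aF ->]; apply: fold_refl_unit. Qed.

Lemma weyl_tau_unit w : weyl_tau F w -> w \in unitmx.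
Proof. exact: generated_unit weyl_tau_gen_unit _. Qed.

Lemma weyl_tau_inv w : weyl_tau F w -> weyl_tau F (invmx w).
Proof. exact: generated_inv weyl_tau_gen_unit _. Qed.

Lemma fold_refl_T a : a \in fold_index F -> T_commuting (fold_refl F a).
Proof.
rewrite /fold_refl /fold_index mem_cat mem_filter.
case: ifP => [aF|_] /=.
  have [aD [b bD Ta]] := fr_rat_T aF; rewrite Ta => _.
  by apply: refl_T_rational => //; [exact: (simple_sub DeltaP) |
    exact: (simple_sub DeltaP) | exact: (fr_rat_rational (f:=F))].
by move=> /andP[/eqP Ta aD]; apply: refl_T_fixed => //; apply: (simple_sub DeltaP).
Qed.

Lemma weyl_tau_T w : weyl_tau F w -> T_commuting w.
Proof.
elim=> [u|g h [a aF ->] _ IH u|g h [a aF ->] _ IH u]; first by rewrite !mulmx1.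
  by rewrite !mulmxA IH fold_refl_T.
have gu := fold_refl_unit aF.
rewrite !mulmxA IH; congr (_ *m _).
by rewrite -{2}[u](mulmxKV gu) fold_refl_T // mulmxK.
Qed.

Section PiStar.
Variables (split : bool) (lR : {rmorphism l_star c1 c2 split -> R}).
Hypothesis caseP : folding_case lR.
Local Notation ext := (@ext_mx k c1 c2 split (n + n) (n + n)).
Local Notation pi := (@pi_star k c1 c2 n split).

Lemma pi_star_mul u w : T_commuting w -> pi (u *m w) = pi u *m ext w.
Proof.
move=> Tw; rewrite /pi_star /ext_mx; case: (split) => /=.
  by rewrite map_mx_id // -scalemxAl mulmxDl Tw.
by rewrite -scalemxAl mulmxBl -scalemxAl Tw !map_mxM.
Qed.

(** The matrix of [T] commutes with [T], so equivariance of [pi] reduces this to the eigenspace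
    property of its image. *)
Lemma pi_star_T u : pi (T u) = tau_star c1 c2 split *: pi u.
Proof.
rewrite -(pi_star_U_star u caseP) T_opE pi_star_mul // => v.
by rewrite -!T_opE.
Qed.

End PiStar.

(** * Injectivity properties of [pi_star] *)

Lemma scaler_cancel (L : comNzRingType) (V : lmodType L) (t s : L) (x y : V) :
  t * s = 1 -> s *: x = s *: y -> x = y.
Proof. by move=> ts1 /(congr1 (fun z => t *: z)); rewrite !scalerA ts1 !scale1r. Qed.

(** Since [sigma] is [c1 - tau], the vector [T u - sigma u] has [u] itself as its [tau]-coordinate,
    and [pr_tau'] recovers it. *)
Lemma pi_tau_inj : quad_disc c1 c2 \is a GRing.unit ->
  injective (@pi_star k c1 c2 n false).
Proof.
move=> Du u v /= piE.
have uv := scaler_cancel (tau_sigma_invP Du) piE.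
have entry (L : comNzRingType) (h : {rmorphism k -> L}) (t : L) (x x' y y' : U) i :
    map_mx h x - (h c1 - t) *: map_mx h y = map_mx h x' - (h c1 - t) *: map_mx h y' ->
    h (x 0 i - x' 0 i - c1 * (y 0 i - y' 0 i)) + t * h (y 0 i - y' 0 i) = 0.
  move=> /rowP/(_ i); rewrite !mxE => /eqP; rewrite -subr_eq0 => /eqP <-.
  by rewrite !(rmorphB, rmorphM) /=; ring.
apply/rowP => i; have := entry _ _ _ _ _ _ _ i uv.
move=> /(congr1 (@pr_tau' k c1 c2)).
rewrite /pr_tau' quad_coef coefD coefZ coefC coefX /= mulr1 add0r coef0 => /eqP.
by rewrite subr_eq0 => /eqP.
Qed.

(** The element [w *m invmx w'] fixes [theta + T theta]. Both summands are dominant because [T] maps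
    simple roots to simple roots, so [stab_dominant_sum] applies. *)
Lemma pi_split_inj w w' theta : (2 : k) \is a GRing.unit -> quad_poly c1 c2 = 'X^2 - 1 ->
  weyl_tau F w -> weyl_tau F w' -> dominant F theta ->
  @pi_star k c1 c2 n true (theta *m w) = @pi_star k c1 c2 n true (theta *m w') ->
  theta *m w = theta *m w'.
Proof.
move=> two_unit p1 Ww Ww' th0 /= /(scaler_cancel (divrr two_unit)).
rewrite (weyl_tau_T Ww) (weyl_tau_T Ww') -!mulmxDl => fixw.
have u' := weyl_tau_unit Ww'.
have Wv : weyl_tau F (w *m invmx w') by apply: generated_mul (weyl_tau_inv Ww').
have {}fixw : (theta + T theta) *m (w *m invmx w') = theta + T theta.
  by rewrite mulmxA fixw mulmxK.
have Dsub := simple_sub DeltaP.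
have c10 : c1 = 0.
  have := congr1 (fun p : {poly k} => p`_1) p1; rewrite /quad_poly !coefE /=.
  by rewrite !mulr1 !addr0 !sub0r oppr0 => /eqP; rewrite oppr_eq0 => /eqP.
have TT u : T (T u) = u.
  by rewrite folded_T_sqr c10 scale0r add0r.
(* Roots in the [T]-image of [fr_rat F] return to [fr_rat F] because [T] is an involution here. *)
have T_simple a : a \in Delta -> exists2 b, b \in Delta & T (incl a) = incl b.
  move=> aD; have : incl a \in map incl Delta by rewrite map_f.
  rewrite (perm_mem (fr_Delta F)) !mem_cat => /or3P[] /mapP[b].
  - rewrite mem_filter => /andP[/eqP Tb bD] ->.
    by exists b.
  - by move=> /fr_rat_T[_ [c cD Tb]] ->; exists c.
  - by move=> /fr_rat_T[bD _] ->; exists b; rewrite ?TT.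
have th0' : {in Delta, forall a, 0 <= kR (dotp theta (incl a))}.
  by move=> a aD; rewrite (fr_dot F) th0.
have Tth0 : {in Delta, forall a, 0 <= kR (dotp (T theta) (incl a))}.
  by move=> a aD; have [b bD Tab] := T_simple a aD; rewrite dotp_T Tab th0'.
have fix_theta := stab_dominant_sum (weyl_tau_sub Dsub Wv) th0' Tth0 fixw.
by rewrite -{2}fix_theta mulmxA mulmxKV.
Qed.

End Reflections.

(** * Pulling back structure algebras *)

Section Pullback.
Variables (k A A' : comNzRingType) (h : {rmorphism k -> A}) (h' : {rmorphism k -> A'}).
Variables (m m' : nat) (X X' : Type) (x0 : X) (x0' : X').
Variables (edge : X -> X -> {mpoly A[m]} -> Prop).
Variables (edge' : X' -> X' -> {mpoly A'[m']} -> Prop).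
Variables (j : X' -> X) (p : {rmorphism {mpoly A[m]} -> {mpoly A'[m']}}).
Local Notation Z := (str_alg h x0 edge).
Local Notation Z' := (str_alg h' x0' edge').
Hypothesis p_const : forall c, p (h c)%:MP = (h' c)%:MP.
Hypothesis p_aug : forall s, s@_0%MM = 0 -> (p s)@_0%MM = 0.
Hypothesis pullP : forall z : Z, gkm edge' (fun y => p (fam z (j y))).

Definition pullback (z : Z) : Z' := StrAlg h' x0' (pullP z).

Fact pullback_zmod : zmod_morphism pullback.
Proof. by move=> z w; apply: famE => y /=; rewrite rmorphB. Qed.
Fact pullback_monoid : monoid_morphism pullback.
Proof.
by split=> [|z w]; apply: famE => y /=; rewrite ?rmorph1 ?rmorphM.
Qed.
Fact pullback_scalable : scalable pullback.
Proof. by move=> c z; apply: famE => y /=; rewrite rmorphM /= p_const. Qed.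
HB.instance Definition _ := GRing.isZmodMorphism.Build Z Z' pullback pullback_zmod.
HB.instance Definition _ := GRing.isMonoidMorphism.Build Z Z' pullback pullback_monoid.
HB.instance Definition _ := GRing.isScalable.Build k Z Z' *:%R pullback pullback_scalable.

Definition pullback_lrmorphism : {lrmorphism Z -> Z'} := pullback.

Lemma pullback_aug_ideal z :
  z \in @aug_ideal k A h m X x0 edge -> pullback z \in @aug_ideal k A' h' m' X' x0' edge'.
Proof.
move=> /asboolP [s [s0 ->]]; apply/asboolP.
exists [seq (p q.1, pullback q.2) | q <- s]; split.
  by move=> q /mapP [q' /s0 /p_aug q'0 ->].
rewrite rmorph_sum big_map; apply: eq_bigr => q _; rewrite rmorphM /=.
by congr (_ * _); apply: famE => y.
Qed.

Local Notation Zbar := (aug_alg h x0 edge).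
Local Notation Zbar' := (aug_alg h' x0' edge').
Local Notation proj := (@aug_proj k A h m X x0 edge).
Local Notation proj' := (@aug_proj k A' h' m' X' x0' edge').

Definition aug_pullback (q : Zbar) : Zbar' := proj' (pullback (generic_quotient.repr q)).

(** Two representatives of a class differ by an element of the augmentation ideal, which [pullback]
    maps into its counterpart; the choice made by [repr] is therefore immaterial. *)
Lemma aug_pullbackE z : aug_pullback (proj z) = proj' (pullback z).
Proof.
apply/eqP; rewrite /aug_pullback /aug_proj -Quotient.idealrBE -rmorphB.
apply: pullback_aug_ideal; rewrite Quotient.idealrBE.
by rewrite generic_quotient.reprK.
Qed.

Lemma aug_proj_surj q : exists z, q = proj z.
Proof. by exists (generic_quotient.repr q); rewrite /aug_proj generic_quotient.reprK. Qed.

Fact aug_pullback_zmod : zmod_morphism aug_pullback.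
Proof.
move=> p1 p2; have [z ->] := aug_proj_surj p1; have [w ->] := aug_proj_surj p2.
by rewrite -rmorphB !aug_pullbackE !rmorphB.
Qed.
Fact aug_pullback_monoid : monoid_morphism aug_pullback.
Proof.
split=> [|p1 p2].
  by rewrite -(rmorph1 (aug_proj (edge := edge))) aug_pullbackE !rmorph1.
have [z ->] := aug_proj_surj p1; have [w ->] := aug_proj_surj p2.
by rewrite -rmorphM !aug_pullbackE !rmorphM.
Qed.
Fact aug_pullback_scalable : scalable aug_pullback.
Proof.
by move=> c p1; have [z ->] := aug_proj_surj p1; rewrite -linearZ !aug_pullbackE !linearZ.
Qed.
HB.instance Definition _ :=
  GRing.isZmodMorphism.Build Zbar Zbar' aug_pullback aug_pullback_zmod.
HB.instance Definition _ :=
  GRing.isMonoidMorphism.Build Zbar Zbar' aug_pullback aug_pullback_monoid.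
HB.instance Definition _ :=
  GRing.isScalable.Build k Zbar Zbar' *:%R aug_pullback aug_pullback_scalable.

Definition aug_pullback_lrmorphism : {lrmorphism Zbar -> Zbar'} := aug_pullback.

End Pullback.

(** * The folded graph *)

Section Folding.
Variables (R : realType) (k : idomainType) (kR : {rmorphism k -> R}).
Hypothesis kR_inj : injective kR.
Variables (c1 c2 : k).
Hypothesis disc_unit : quad_disc c1 c2 \is a GRing.unit.
Variables (split : bool) (lR : {rmorphism l_star c1 c2 split -> R}).
Hypothesis caseP : folding_case lR.
Variables (r n : nat) (RD : root_datum r) (Delta : seq 'rV[int]_r).
Hypothesis DeltaP : simple_roots RD Delta.
Variable F : folded_rep kR c1 c2 n RD Delta.
Variables (m : nat) (E : 'M[l_star c1 c2 split]_(m, n + n)).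
Hypothesis E_basis : Lambda_tau_basis F E.
Variable theta : 'rV[k]_(n + n).
Hypothesis theta_dominant : dominant F theta.
Local Notation Lambda := 'rV[int]_r.
Local Notation Phi := (Defs.roots RD).
Local Notation incl := (fr_incl F).
Local Notation refl a := (fr_refl F (incl a)).
Local Notation T := (@T_op k c1 c2 n).
Local Notation ls := (l_star c1 c2 split).
Local Notation ext := (@ext_mx k c1 c2 split (n + n) (n + n)).
Local Notation pi := (@pi_star k c1 c2 n split).

Lemma ext_mul w w' : ext (w *m w') = ext w *m ext w'.
Proof. exact: map_mxM. Qed.

Lemma iota_unique w w' : weyl_tau F w -> weyl_tau F w' ->
  pi theta *m ext w = pi theta *m ext w' -> theta *m w = theta *m w'.
Proof.
move=> Ww Ww'; have Tw := weyl_tau_T kR_inj DeltaP Ww.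
have Tw' := weyl_tau_T kR_inj DeltaP Ww'; rewrite -!pi_star_mul //.
case: (split) (lR) caseP => lR' /= [].
  move=> p1 two_unit _.
  exact: (pi_split_inj kR_inj DeltaP two_unit p1 Ww Ww' theta_dominant).
by move=> _ _ /(pi_tau_inj disc_unit).
Qed.

Lemma iota_graph_unique (y : orbit_tau F split theta) (x : Defs.orbit F theta) w :
  iota_graph y x -> weyl_tau F w -> sval y = pi theta *m ext w ->
  sval x = theta *m w.
Proof.
by move=> [w' [Ww' yE ->]] Ww yE'; apply: iota_unique => //; rewrite -yE yE'.
Qed.

Lemma iota_ex (y : orbit_tau F split theta) : exists x, iota_graph y x.
Proof. exact: iota_total (simple_sub DeltaP). Qed.

Definition iota_map (y : orbit_tau F split theta) : Defs.orbit F theta :=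
  sval (cid (iota_ex y)).

Lemma iota_mapP y : iota_graph y (iota_map y).
Proof. by rewrite /iota_map; case: cid. Qed.

Lemma orbit_inj (x x' : Defs.orbit F theta) : sval x = sval x' -> x = x'.
Proof.
case: x x' => x xP [x' x'P] /= xx'; subst x'.
by congr exist; apply: Prop_irrelevance.
Qed.

Lemma orbit_mul (x : Defs.orbit F theta) g : weyl F Delta g ->
  exists x' : Defs.orbit F theta, sval x' = sval x *m g.
Proof.
move=> Wg; have [w Ww xE] := svalP x.
have xgP : exists2 v, weyl F Delta v & sval x *m g = theta *m v.
  by exists (w *m g); [exact: generated_mul | rewrite xE mulmxA].
by exists (exist (fun x => exists2 v, weyl F Delta v & x = theta *m v) _ xgP).
Qed.

Lemma sym_LambdaN (a : Lambda) : sym_Lambda k (- a) = - sym_Lambda k a.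
Proof.
rewrite /sym_Lambda /sym_lin -sumrN; apply: eq_bigr => i _.
by rewrite !mxE rmorphN scaleNr.
Qed.

(** Edges are given for positive roots only, but conjugating by [w] may produce a negative root; its
    opposite has the same reflection, and the sign goes into the cofactor. *)
Lemma edge_root (z : Z_G F theta) (x x' : Defs.orbit F theta) a : a \in Phi ->
  sval x' = sval x *m refl a -> exists s, fam z x - fam z x' = sym_Lambda k a * s.
Proof.
move=> aR x'E; case: (simple_span DeltaP aR) => [a0|aN].
  by apply: (famP z); exists a.
have [|s ->] := famP z (x := x) (x' := x') (a := sym_Lambda k (- a)).
  exists (- a); split=> //; last by rewrite (refl_opp kR_inj).
  by split=> //; apply: root_opp.
by exists (- s); rewrite sym_LambdaN mulNr mulrN.
Qed.

Lemma refl_weyl_conj w a b : weyl F Delta w -> w \in unitmx -> a \in Phi -> b \in Phi ->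
  incl a *m w = incl b -> invmx w *m refl a *m w = refl b.
Proof.
move=> Ww wu aR bR ab; rewrite -mulmxA (refl_conj kR_inj _ aR bR ab) ?mulKmx //.
exact: weyl_isometry Ww.
Qed.

(** [coords] is 0 by default outside the row space of [E], hence the restriction to vectors coming
    from the lattice. *)
Lemma sym_tau_scale t x : sym_tau E (t *: pi (incl x)) = t *: sym_tau E (pi (incl x)).
Proof.
have [b bE] : exists b, pi (incl x) = b *m E.
  by apply/E_basis.2; exists [:: (1, x)]; rewrite big_seq1 scale1r.
rewrite (sym_tauE E_basis bE) (@sym_tauE _ _ _ _ _ _ _ _ _ _ _ _ _ _ (t *: b) E_basis).
  by rewrite /sym_lin scaler_sumr; apply: eq_bigr => i _; rewrite mxE scalerA.
by rewrite bE scalemxAl.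
Qed.

(** The map [pi_S], bundled with its ring morphism structure. *)
Definition pi_S_rmorph : {rmorphism {mpoly k[r]} -> {mpoly ls[m]}} :=
  mmap (@mpolyC m ls \o to_star c1 c2 split)
       (fun i => sym_tau E (pi (incl (delta_mx 0 i)))).

Lemma pi_S_const c : pi_S_rmorph c%:MP = (to_star c1 c2 split c)%:MP.
Proof. exact: mmapC. Qed.

Lemma sym_lin_aug (A : comNzRingType) q (b : 'rV[A]_q) : (sym_lin b)@_0%MM = 0.
Proof.
rewrite /sym_lin raddf_sum big1 // => i _ /=.
by rewrite mcoeffZ mcoeffX mnm1_eq0 mulr0.
Qed.

Lemma pi_S_aug s : s@_0%MM = 0 -> (pi_S_rmorph s)@_0%MM = 0.
Proof.
(* Constant terms correspond because every variable goes to a linear form. *)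
suff -> : (pi_S_rmorph s)@_0%MM = to_star c1 c2 split s@_0%MM.
  by move=> ->; rewrite rmorph0.
elim/mpolyind: s => [|c d s _ _ IH]; first by rewrite !raddf0.
rewrite !raddfD /= IH; congr (_ + _).
rewrite -mul_mpolyC rmorphM /= pi_S_const rmorphM /= mcoeffC eqxx mulr1.
rewrite mul_mpolyC mcoeffZ mcoeffX rmorphM; congr (_ * _).
rewrite [pi_S_rmorph _]mmapX.
have [->|d0] := eqVneq d 0%MM; first by rewrite mmap11 rmorph1 rmorph1.
(* One variable occurring in the monomial suffices: its image has zero constant term. *)
have [i di] : exists i, d i != 0%N.
  by apply/existsP; apply: contraR d0 => /existsPn d0; apply/eqP/mnmP => i;
    rewrite mnm0E; apply/eqP; have := d0 i; rewrite negbK.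
rewrite rmorph0 /mmap1 rmorph_prod (bigD1 i) //= rmorphXn /= sym_lin_aug.
by rewrite expr0n (negPf di) mul0r.
Qed.

Lemma edge_tau_pull (z : Z_G F theta) y y' s : edge_tau lR E y y' s ->
  exists t, pi_S_rmorph (fam z (iota_map y)) - pi_S_rmorph (fam z (iota_map y')) = s * t.
Proof.
move=> [w [a [b [[Ww aF] -> _ y'E ->]]]].
have [v [Wv yE xE]] := iota_mapP y.
have Dsub := simple_sub DeltaP.
have Ww' := weyl_tau_sub Dsub Ww.
have wu := weyl_tau_unit DeltaP Ww.
have Tw := weyl_tau_T kR_inj DeltaP Ww.
have Wr : weyl_tau F (fold_refl F a).
  by apply: generated_in; exists a.
have Wg : weyl_tau F (v *m (invmx w *m fold_refl F a *m w)).
  apply: generated_mul => //; apply: generated_mul => //; apply: generated_mul => //.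
  exact: (weyl_tau_inv DeltaP).
(* By uniqueness, the lift of [y'] can be computed from any element of [weyl_tau F] carrying the
   base point to [y']. *)
have x'E : sval (iota_map y') = sval (iota_map y) *m (invmx w *m fold_refl F a *m w).
  rewrite xE -mulmxA; apply: (iota_graph_unique (iota_mapP y')) => //.
  by rewrite y'E yE ext_mul mulmxA.
have pi_sym c : pi_S_rmorph (sym_Lambda k c) = sym_tau E (pi (incl c)).
  exact: pi_S_Lambda.
move: aF x'E; rewrite /fold_index mem_cat mem_filter /fold_refl.
case: ifP => [aF _|_ /= /andP[_ aD]].
  have [aD [b' bD Ta]] := fr_rat_T aF; rewrite Ta.
  have aR := Dsub _ aD; have bR := Dsub _ bD.
  have [a1 a1R a1E] := weyl_root kR_inj DeltaP Ww' aR.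
  have [b1 b1R b1E] := weyl_root kR_inj DeltaP Ww' bR.
  (* Conjugation by [w] replaces the two roots by their images, so the folded edge lifts to a path
     of two edges, with middle vertex [x1] below. *)
  have -> : invmx w *m (refl a *m refl b') *m w = refl a1 *m refl b1.
    rewrite -(refl_weyl_conj Ww' wu aR a1R a1E) -(refl_weyl_conj Ww' wu bR b1R b1E).
    by rewrite !mulmxA mulmxK.
  move=> x'E.
  have Wa1 : weyl F Delta (refl a1).
    rewrite -(refl_weyl_conj Ww' wu aR a1R a1E); apply: generated_mul => //.
    apply: generated_mul; first by apply: generated_inv => //; apply: weyl_gen_unit.
    by apply: generated_in; exists a.
  have [x1 x1E] : exists x1 : Defs.orbit F theta, sval x1 = sval (iota_map y) *m refl a1
    by exact: orbit_mul.
  have [s1 s1E] := edge_root z a1R x1E.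
  have [s2 s2E] : exists s2, fam z x1 - fam z (iota_map y') = sym_Lambda k b1 * s2.
    by apply: edge_root => //; rewrite x'E x1E mulmxA.
  (* As [w] commutes with [T], the image of [T a] is [T] of the image of [a]. *)
  have Tb : pi (incl b1) = tau_star c1 c2 split *: pi (incl a1).
    by rewrite -b1E -Ta -Tw a1E (pi_star_T caseP).
  (* The differences along the path are multiples of [a1] and [b1]; after projection the second root
     is [tau_star] times the first. *)
  exists (pi_S_rmorph s1 + (tau_star c1 c2 split)%:MP * pi_S_rmorph s2).
  rewrite -rmorphB -(subrKA (fam z x1)) s1E s2E rmorphD !rmorphM !pi_sym Tb sym_tau_scale.
  by rewrite -pi_star_mul // a1E mulrDr -mul_mpolyC mulrA [_ * _%:MP]mulrC.
have aR := Dsub _ aD.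
have [a1 a1R a1E] := weyl_root kR_inj DeltaP Ww' aR.
rewrite (refl_weyl_conj Ww' wu aR a1R a1E) => x'E.
have [s1 s1E] := edge_root z a1R x'E.
exists (pi_S_rmorph s1).
by rewrite -rmorphB s1E rmorphM pi_sym -pi_star_mul // a1E.
Qed.

End Folding.

Theorem theorem6p2
  (R : realType) (k : idomainType)
  (kR : {rmorphism k -> R}) (kR_inj : injective kR)
  (c1 c2 : k) (c2_unit : c2 \is a GRing.unit)
  (disc_unit : quad_disc c1 c2 \is a GRing.unit)
  (split : bool)
  (lR : {rmorphism l_star c1 c2 split -> R}) (lR_inj : injective lR)
  (lRE : forall c : k, lR (to_star c1 c2 split c) = kR c)
  (caseP : folding_case lR)
  (r n : nat) (RD : root_datum r) (Delta : seq 'rV[int]_r)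
  (DeltaP : simple_roots RD Delta)
  (F : folded_rep kR c1 c2 n RD Delta)
  (m : nat) (E : 'M[l_star c1 c2 split]_(m, n + n))
  (E_basis : Lambda_tau_basis F E)
  (Theta : seq 'rV[int]_r) (Theta_sub : {subset Theta <= Delta})
  (Theta_preserved : preserves F Theta)
  (theta : 'rV[k]_(n + n)) (theta_dominant : dominant F theta)
  (theta_stab : forall w : 'M[k]_(n + n),
     weyl F Delta w /\ theta *m w = theta <-> weyl F Theta w) :
  exists iota_star : {lrmorphism Z_G F theta -> Z_G_tau F lR E theta},
    (forall z, iota_rule z (iota_star z)) /\
    exists iota_bar : {lrmorphism Zbar_G F theta -> Zbar_G_tau F lR E theta},
      forall z, iota_bar (f_G F theta z) = f_G_tau F lR E theta (iota_star z).
Proof.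
have pullP (z : Z_G F theta) : gkm (@edge_tau R k kR c1 c2 r n RD Delta F split lR m E theta)
    (fun y => pi_S_rmorph F E (fam z (iota_map DeltaP y))).
  by move=> y y' s; apply: edge_tau_pull.
have constP c : pi_S_rmorph F E ((idfun : {rmorphism k -> k}) c)%:MP
    = (to_star c1 c2 split c)%:MP by exact: pi_S_const.
exists (pullback_lrmorphism (orbit_tau_base F split theta) constP pullP); split.
  (* The rule allows any [x] related to [y]; uniqueness identifies it with the chosen [iota_map]. *)
  move=> z y x yx; congr (pi_S F E (fam z _)).
  have [w [Ww yE xE]] := iota_mapP DeltaP y.
  apply: orbit_inj; rewrite xE; symmetry.
  exact: (iota_graph_unique kR_inj disc_unit caseP DeltaP theta_dominant yx Ww yE).
have augP s : s@_0%MM = 0 -> (pi_S_rmorph F E s)@_0%MM = 0 by exact: pi_S_aug.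
exists (aug_pullback_lrmorphism (orbit_tau_base F split theta) constP augP pullP).
exact: (aug_pullbackE _ _ augP pullP).
Qed.
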